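(* Suppose that $\varepsilon>0$, $K$ and $L$ are origin-symmetric convex bodies in $\mathbb{R}^n$, and $L$ is a projection body. If for every $\xi\in S^{n-1}$ $$|K\vert \xi^\perp| \le |L\vert \xi^\perp| - \varepsilon,$$ then $$|K|^{\frac{n-1}{n}} \le |L|^{\frac{n-1}{n}} - c_n\,\varepsilon,$$ where $c_n = |B_2^n|^{\frac{n-1}{n}}/|B_2^{n-1}|$.
   Context: $|\cdot|$ denotes volume (Lebesgue measure) of the appropriate dimension; $B_2^n$ is the unit Euclidean ball in $\mathbb{R}^n$; $S^{n-1}$ is the unit Euclidean sphere; for $\xi\in S^{n-1}$, $\xi^\perp$ is the central hyperplane perpendicular to $\xi$, and $K\vert\xi^\perp$ is the orthogonal projection of $K$ to $\xi^\perp$. A convex body is a compact convex set with nonempty interior. The projection body $\Pi K$ of an origin-symmetric convex body $K$ in $\mathbb{R}^n$ is the origin-symmetric convex body in $\mathbb{R}^n$ whose support function satisfies $h_{\Pi K}(\theta)=|K\vert\theta^\perp|$ for every $\theta\in S^{n-1}$, where $h_M(x)=\max_{y\in M}(x,y)$ is the support function of a convex body $M$. A body $L$ is called a projection body if it is the projection body of some convex body. *)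

(* Defs.v *)
From HB Require Import structures.
From mathcomp Require Import all_boot all_order all_algebra.
From mathcomp Require Import all_classical all_reals all_analysis.

Set Implicit Arguments.
Unset Strict Implicit.
Unset Printing Implicit Defensive.

Import Order.TTheory GRing.Theory Num.Theory.
Import numFieldNormedType.Exports.

Local Open Scope classical_set_scope.
Local Open Scope ring_scope.

(* Points of R^n are row vectors 'rV[R]_n. Their topology is the usual one, but
   `|x| on 'rV[R]_n is the sup norm, hence the separate Euclidean norm. *)

Section Euclidean.
Context {R : realType} {n : nat}.
Implicit Types (x y : 'rV[R]_n) (A K L M : set 'rV[R]_n).

Definition dotv x y : R := \sum_(i < n) x ord0 i * y ord0 i.

Definition enorm x : R := Num.sqrt (dotv x x).

Definition eball : set 'rV[R]_n := [set x | enorm x <= 1].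

Definition esphere : set 'rV[R]_n := [set x | enorm x = 1].

Definition convex_body K : Prop :=
  [/\ compact K, convex_set (K : set (convex_lmodType 'rV[R]_n))
    & K° !=set0].

Definition origin_symmetric K : Prop := forall x, K x -> K (- x).

(* On a convex body the supremum is a maximum. *)
Definition support_function M x : R := sup [set dotv x y | y in M].

Definition proj_perp (xi : 'rV[R]_n) K : set 'rV[R]_n :=
  [set x - dotv x xi *: xi | x in K].

(* The rows of B form an orthonormal basis of the hyperplane xi^\perp. *)
Definition perp_frame (xi : 'rV[R]_n) (B : 'M[R]_(n.-1, n)) : Prop :=
  B *m B^T = 1%:M /\ B *m xi^T = 0.

End Euclidean.

Arguments eball {R} n.
Arguments esphere {R} n.

(* Lebesgue measure on R^n, as the n-fold product of the library's
   one-dimensional Lebesgue measure; on R^0 it is the unit point mass. *)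
Fixpoint lebesgue_tuple (R : realType) (n : nat) :
    set (n.-tuple (measurableTypeR R)) -> \bar R :=
  match n with
  | 0 => dirac [tuple]
  | m.+1 => pushforward
      (product_measure1 (@lebesgue_measure R) (@lebesgue_tuple R m))
      (fun p => [tuple of p.1 :: p.2])
  end.

Definition volume (R : realType) (n : nat) (A : set 'rV[R]_n) : R :=
  fine (lebesgue_tuple [set t | A (\row_i tnth t i)]).

(* (n-1)-dimensional volume of a subset of xi^\perp, measured in orthonormal
   coordinates y |-> y *m B of that hyperplane; since Lebesgue measure is
   invariant under orthogonal maps, the choice of B is immaterial. *)
Definition volume_perp (R : realType) (n : nat) (xi : 'rV[R]_n)
    (A : set 'rV[R]_n) : R :=
  let B := xget 0 (perp_frame xi) in
  volume [set y : 'rV[R]_(n.-1) | A (y *m B)].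

(* L = \Pi M. The formula makes sense for every convex body M, symmetric or
   not, and is not restricted to symmetric ones here. *)
Definition projection_body_of (R : realType) (n : nat)
    (M L : set 'rV[R]_n) : Prop :=
  [/\ convex_body L, origin_symmetric L &
    forall theta, esphere n theta ->
      support_function L theta = volume_perp theta (proj_perp theta M)].

Definition projection_body (R : realType) (n : nat)
    (L : set 'rV[R]_n) : Prop :=
  exists2 M : set 'rV[R]_n, convex_body M & projection_body_of M L.

Definition c_ (R : realType) (n : nat) : R :=
  volume (eball n) `^ ((n%:R - 1) / n%:R) / volume (eball n.-1).

(* Main.v *)
(* Write p_K(x) = |K + [0, x]| - |K|.  By Cavalieri, p_K(t xi) = t |K | xi^perp|
   for a unit vector xi, so the hypothesis reads p_K + e p_B <= p_L, where B is
   the unit ball and e = eps / |B^{n-1}|.  If P is a polytope with facet cones C_i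
   and facet normals a_i (normalised so that <a_i, y> = 1 on the facets), then
   p_P(x) = n sum_i |C_i| <a_i, x>_+ (Cauchy), which is the support function of the
   zonotope Z = sum_i [0, n |C_i| a_i].  If L is the projection body of M, its
   support function is p_M, so approximating M by polytopes yields zonotopes
   Z = sum_i [0, z_i] with L <= Z <= lam L and lam > 1 arbitrary.  Letting t tend to
   0 in |A + t L| <= |A + t Z| for A = K, B, the Brunn-Minkowski inequality gives
   n |A|^{(n-1)/n} |L|^{1/n} <= sum_i p_A(z_i), while |L + t Z| <= (1 + t lam)^n |L|
   gives sum_i p_L(z_i) <= n lam |L|.  Summing the hypothesis over the z_i and
   dividing by n |L|^{1/n} concludes.  Lebesgue measure is shown to be invariant
   under isometries by the uniqueness of translation-invariant measures. *)

Require Import Defs.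
From HB Require Import structures.
From mathcomp Require Import all_boot all_order all_algebra.
From mathcomp Require Import all_classical all_reals all_analysis.
From mathcomp Require Import measurable_realfun ring lra.
Set Implicit Arguments.
Unset Strict Implicit.
Unset Printing Implicit Defensive.
Import Order.TTheory GRing.Theory Num.Theory.
Import numFieldNormedType.Exports.
Local Open Scope classical_set_scope.
Local Open Scope ring_scope.

(** * Lebesgue measure on row vectors *)

(** For a zonotope Z with generators z_i, the sum of the p_A(z_i) is the derivative of |A + t Z| at
    t = 0, that is, n times the mixed volume V(A, ..., A, Z). The hypothesis compares K, B and L one
    segment at a time, and it can be summed because this mixed volume is additive in Z; this is
    where the assumption that L is a projection body enters. Mixed volumes are never defined. Since
    p is monotone in the body, |A + t Z| - |A| lies between t times the sum of the p_A(z_i) and the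
    same sum for a slightly larger body, and every limit becomes an inequality with an error of
    order t. Polytopes stand in for the surface area measure of M: the support function of L is
    compared with a finite sum, at the cost of the factor lam. Defining p as a difference of volumes
    makes it independent of the frame of the hyperplane and extends it to all vectors, so generators
    of any length are treated alike. The constant c_n comes from running the lower bound on B as
    well: its contribution after division is e |B|^{(n-1)/n}. *)

Section lebesgue_tuple_measure.
Context {R : realType}.
Local Notation T := (measurableTypeR R).

Let cons_pair n (p : T * n.-tuple T) : n.+1.-tuple T := [tuple of p.1 :: p.2].

Let measurable_cons_pair n : measurable_fun setT (@cons_pair n).
Proof. exact: measurable_cons. Qed.

(** Additivity and sigma-finiteness go through one induction, because the product in dimension n + 1
    is a measure only once the factor in dimension n is known to be a sigma-finite measure. The
    instances below are read off from this existential. *)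
Lemma lebesgue_tuple_sigma_finite_measure n :
  exists mu : {sigma_finite_measure set (n.-tuple T) -> \bar R},
    (mu : set _ -> _) = @lebesgue_tuple R n.
Proof.
elim: n => [|n [mu muE]].
  by exists (dirac ([tuple] : 0.-tuple T) : {sigma_finite_measure set _ -> \bar R}).
pose m1 : {sigma_finite_measure set T -> \bar R} := @lebesgue_measure R.
have mE : @lebesgue_tuple R n.+1 = pushforward (m1 \x mu)%E (@cons_pair n).
  by rewrite /= muE.
pose f := pushforward (m1 \x mu)%E (@cons_pair n).
have f0 : f set0 = 0%E by rewrite /f /pushforward preimage_set0 measure0.
have fge0 A : (0 <= f A)%E by rewrite /f /pushforward measure_ge0.
have mpre A : measurable A -> measurable (@cons_pair n @^-1` A).
  by move=> mA; rewrite -[X in measurable X]setTI; exact: measurable_cons_pair.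
have fs : semi_sigma_additive f.
  move=> F mF tF mUF; rewrite /f /pushforward preimage_bigcup.
  apply: measure_semi_sigma_additive.
  - by move=> i; exact: mpre.
  - apply/trivIsetP => i j _ _ ij; rewrite -preimage_setI.
    by move/trivIsetP : tF => /(_ _ _ _ _ ij) ->//; rewrite preimage_set0.
  - by rewrite -preimage_bigcup; exact: mpre.
pose uncons (t : n.+1.-tuple T) : T * n.-tuple T := (thead t, [tuple of behead t]).
have unconsK t : cons_pair (uncons t) = t.
  by rewrite /cons_pair /uncons /= [RHS]tuple_eta; apply/val_inj.
have consK p : uncons (cons_pair p) = p.
  case: p => x t; rewrite /cons_pair /uncons /= theadE; congr pair.
  by apply/val_inj.
have muncons : measurable_fun setT uncons.
  apply/measurable_fun_pair; first exact: measurable_tnth.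
  exact: measurable_behead.
have fsf : sigma_finite setT f.
  have /sigma_finiteP[F [FT Fnd Ffin]] := sigma_finiteT m1.
  have /sigma_finiteP[G [GT Gnd Gfin]] := sigma_finiteT mu.
  exists (fun k => uncons @^-1` (F k `*` G k)).
    rewrite -preimage_bigcup (_ : \bigcup_k _ = setT) ?preimage_setT//.
    rewrite -setXTT FT GT predeqE => -[x y]; split.
      by move=> [k _ []/= ? ?]; split; exists k.
    move=> [/= [k _ Fnx] [l _ Gky]]; exists (maxn k l) => //; split.
    - by move: x Fnx; exact/subsetPset/Fnd/leq_maxl.
    - by move: y Gky; exact/subsetPset/Gnd/leq_maxr.
  move=> k; have [mF Foo] := Ffin k; have [mG Goo] := Gfin k; split.
    rewrite -[X in measurable X]setTI; apply: muncons => //.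
    exact: measurableX.
  rewrite /f /pushforward -comp_preimage.
  rewrite (_ : uncons \o _ = id); last by apply/funext => p /=; rewrite consK.
  by rewrite preimage_id product_measure1E// lte_mul_pinfty// ge0_fin_numE.
have fE : @lebesgue_tuple R n.+1 = f by rewrite mE.
clearbody f.
pose m := isMeasure.Build _ _ _ f f0 fge0 fs.
pose s := Measure_isSigmaFinite.Build _ _ _ (HB.pack_for {measure set _ ->
  \bar R} f m) fsf.
exists (HB.pack_for {sigma_finite_measure set (n.+1.-tuple T) -> \bar R} f m s).
by rewrite fE.
Qed.

Section instances.
Variable n : nat.

Let lt0 : @lebesgue_tuple R n set0 = 0%E.
Proof.
by have [mu <-] := lebesgue_tuple_sigma_finite_measure n; rewrite measure0.
Qed.

Let lt_ge0 A : (0 <= @lebesgue_tuple R n A)%E.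
Proof. by have [mu <-] := lebesgue_tuple_sigma_finite_measure n. Qed.

Let lt_sigma_additive : semi_sigma_additive (@lebesgue_tuple R n).
Proof.
have [mu <-] := lebesgue_tuple_sigma_finite_measure n.
exact: measure_semi_sigma_additive.
Qed.

Let lt_sigma_finite : sigma_finite setT (@lebesgue_tuple R n).
Proof.
have [mu <-] := lebesgue_tuple_sigma_finite_measure n.
exact: sigma_finiteT.
Qed.

HB.instance Definition _ := isMeasure.Build _ _ _ (@lebesgue_tuple R n)
  lt0 lt_ge0 lt_sigma_additive.

HB.instance Definition _ := Measure_isSigmaFinite.Build _ _ _
  (@lebesgue_tuple R n) lt_sigma_finite.

End instances.

End lebesgue_tuple_measure.

Section measurable_rV.
Context {R : realType} (n : nat).
Local Notation T := (measurableTypeR R).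

Definition rV_of_tuple (t : n.-tuple T) : 'rV[R]_n := \row_i tnth t i.

(** The sigma-algebra is carried over from tuples, so that [volume A] is [fine (leb A)] by
    definition. *)
Definition rV_measurable (A : set 'rV[R]_n) := measurable (rV_of_tuple @^-1` A).

Let rV_measurable0 : rV_measurable set0.
Proof. by rewrite /rV_measurable preimage_set0. Qed.

Let rV_measurableC A : rV_measurable A -> rV_measurable (~` A).
Proof. by rewrite /rV_measurable preimage_setC; exact: measurableC. Qed.

Let rV_measurable_bigcup (F : (set 'rV[R]_n)^nat) :
  (forall i, rV_measurable (F i)) -> rV_measurable (\bigcup_i F i).
Proof. by rewrite /rV_measurable preimage_bigcup; exact: bigcupT_measurable. Qed.

HB.instance Definition _ := @isMeasurable.Build default_measure_display
  'rV[R]_n rV_measurable rV_measurable0 rV_measurableC rV_measurable_bigcup.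

Lemma measurable_rV_of_tuple : measurable_fun setT rV_of_tuple.
Proof. by move=> _ A mA; rewrite setTI. Qed.

Definition leb (A : set 'rV[R]_n) : \bar R :=
  lebesgue_tuple (rV_of_tuple @^-1` A).

Let leb0 : leb set0 = 0%E.
Proof. by rewrite /leb preimage_set0 measure0. Qed.

Let leb_ge0 A : (0 <= leb A)%E.
Proof. exact: measure_ge0. Qed.

Let leb_sigma_additive : semi_sigma_additive leb.
Proof.
move=> F mF tF mUF; rewrite /leb preimage_bigcup.
apply: measure_semi_sigma_additive => //.
  apply/trivIsetP => i j _ _ ij; rewrite -preimage_setI.
  by move/trivIsetP : tF => /(_ _ _ _ _ ij) ->//; rewrite preimage_set0.
Qed.

HB.instance Definition _ := isMeasure.Build _ _ _ leb
  leb0 leb_ge0 leb_sigma_additive.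

Let rV_to_tupleK : cancel rV_of_tuple (fun x : 'rV[R]_n => [tuple x ord0 i | i <
  n]).
Proof. by move=> t; apply: eq_from_tnth => i; rewrite tnth_mktuple mxE. Qed.

Let leb_sigma_finite : sigma_finite setT leb.
Proof.
have [F FT Ffin] := sigma_finiteT (@lebesgue_tuple R n).
pose g (x : 'rV[R]_n) := [tuple x ord0 i | i < n] : n.-tuple T.
have gK A : rV_of_tuple @^-1` (g @^-1` A) = A.
  by apply/seteqP; split => t /=; rewrite /g rV_to_tupleK.
exists (fun k => g @^-1` F k); first by rewrite -preimage_bigcup -FT preimage_setT.
move=> k; have [mF Foo] := Ffin k.
by split; rewrite /leb /measurable/= ?/rV_measurable gK.
Qed.

HB.instance Definition _ := Measure_isSigmaFinite.Build _ _ _ leb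
  leb_sigma_finite.

End measurable_rV.
Arguments leb {R n}.

Section measurable_rV_lemmas.
Context {R : realType}.
Local Notation T := (measurableTypeR R).

Lemma measurable_coord n (i : 'I_n) :
  measurable_fun setT (fun x : 'rV[R]_n => x ord0 i : T).
Proof.
move=> _ A mA; rewrite setTI /measurable/= /rV_measurable -comp_preimage.
rewrite (_ : _ \o _ = fun t : n.-tuple T => tnth t i); last first.
  by apply/funext => t /=; rewrite mxE.
by rewrite -[X in measurable X]setTI; exact: measurable_tnth.
Qed.

Lemma measurable_fun_rV d (U : measurableType d) n (f : U -> 'rV[R]_n) :
  (forall i, measurable_fun setT (fun u => f u ord0 i : T)) ->
  measurable_fun setT f.
Proof.
move=> mf; rewrite (_ : f = @rV_of_tuple R n \o
    (fun u => [tuple (f u ord0 i : T) | i < n])); last first.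
  by apply/funext => u; apply/rowP => i; rewrite mxE tnth_mktuple.
apply: measurableT_comp; first exact: measurable_rV_of_tuple.
apply/measurable_fun_tnthP => i.
rewrite (_ : _ \o _ = fun u => f u ord0 i : T); first exact: mf.
by apply/funext => u /=; rewrite tnth_mktuple.
Qed.

Lemma measurable_fun_rVD d (U : measurableType d) n (f g : U -> 'rV[R]_n) :
  measurable_fun setT f -> measurable_fun setT g ->
  measurable_fun setT (fun u => f u + g u).
Proof.
move=> mf mg; apply: measurable_fun_rV => i.
under eq_fun do rewrite mxE.
by apply: measurable_funD; apply: (measurableT_comp (measurable_coord i)).
Qed.

Lemma measurable_fun_rV_mulmx d (U : measurableType d) n m (f : U -> 'rV[R]_n)
    (Q : 'M[R]_(n, m)) :
  measurable_fun setT f -> measurable_fun setT (fun u => f u *m Q).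
Proof.
move=> mf; apply: measurable_fun_rV => i.
under eq_fun do rewrite mxE.
apply: measurable_sum => j; apply: measurable_funM => //.
exact: (measurableT_comp (measurable_coord j)).
Qed.

Lemma row_mx_ord0 m (s : R) (y : 'rV[R]_m) :
  (row_mx s%:M y : 'rV[R]_(m.+1)) ord0 ord0 = s.
Proof.
have := @row_mxEl R 1 1 m s%:M y ord0 ord0; rewrite [RHS]mxE eqxx mulr1n => {2}<-.
by congr (row_mx _ _ _ _); exact/val_inj.
Qed.

Lemma row_mx_lift m (s : R) (y : 'rV[R]_m) (j : 'I_m) :
  (row_mx s%:M y : 'rV[R]_(m.+1)) ord0 (lift ord0 j) = y ord0 j.
Proof.
have := @row_mxEr R 1 1 m s%:M y ord0 j => <-.
by congr (row_mx _ _ _ _); exact/val_inj.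
Qed.

Lemma measurable_row_mx m :
  measurable_fun setT (fun p : T * 'rV[R]_m => row_mx p.1%:M p.2 : 'rV[R]_(m.+1)).
Proof.
apply: measurable_fun_rV => i; case: (unliftP ord0 i) => [j ->|->].
  rewrite (_ : (fun u => _) = fun u : T * 'rV[R]_m => u.2 ord0 j : T).
    by apply: (measurableT_comp (measurable_coord j)); exact: measurable_snd.
  by apply/funext => p; rewrite row_mx_lift.
rewrite (_ : (fun u => _) = fst); first exact: measurable_fst.
by apply/funext => p; rewrite row_mx_ord0.
Qed.

Lemma rV_of_tuple_cons m (s : T) (t : m.-tuple T) :
  rV_of_tuple [tuple of s :: t] = row_mx s%:M (rV_of_tuple t) :> 'rV[R]_(m.+1).
Proof.
apply/rowP => i; rewrite mxE; case: (unliftP ord0 i) => [j ->|->].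
  by rewrite row_mx_lift mxE tnthS.
by rewrite row_mx_ord0.
Qed.

Definition cons_pre m (A : set 'rV[R]_(m.+1)) : set (T * 'rV[R]_m) :=
  (fun p => row_mx p.1%:M p.2) @^-1` A.

Lemma measurable_cons_pre m (A : set 'rV[R]_(m.+1)) :
  measurable A -> measurable (cons_pre A).
Proof.
by move=> mA; rewrite -[X in measurable X]setTI; exact: measurable_row_mx.
Qed.

Lemma leb_cons m (A : set 'rV[R]_(m.+1)) :
  leb A = (@lebesgue_measure R \x @leb R m)%E (cons_pre A).
Proof.
rewrite /leb /= /pushforward /product_measure1; apply: eq_integral => s _ /=.
congr lebesgue_tuple; apply/seteqP; split => t /=;
  by rewrite /xsection /cons_pre /= !inE /= rV_of_tuple_cons.
Qed.

Lemma leb_cons2 m (A : set 'rV[R]_(m.+1)) : measurable A ->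
  leb A = (@lebesgue_measure R \x^ @leb R m)%E (cons_pre A).
Proof.
move=> mA; rewrite leb_cons; apply: product_measure_unique.
  by move=> B C mB mC; exact: product_measure2E.
exact: measurable_cons_pre.
Qed.

Lemma lebesgue_measure_shift (c : R) (A : set T) : measurable A ->
  pushforward lebesgue_measure (fun x : T => x + c : T) A = lebesgue_measure A.
Proof.
move=> mA; apply/esym.
have mf : measurable_fun setT (fun x : T => x + c : T).
  exact: measurable_funD.
apply: lebesgue_measure_unique => //= _ [[a b]] _ <-.
rewrite /pushforward (_ : _ @^-1` _ = `]a - c, b - c]%classic); last first.
  by apply/seteqP; split => x /=; rewrite !in_itv /= ltrBlDr lerBrDr.
rewrite !lebesgue_measure_itv/= !lte_fin ltrD2r; case: ifP => // _.
by rewrite -!EFinB opprB addrA subrK.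
Qed.

Lemma row_mxD1 m (s t : R) (x y : 'rV[R]_m) :
  row_mx s%:M x + row_mx t%:M y = row_mx (s + t)%:M (x + y) :> 'rV[R]_(m.+1).
Proof. by rewrite raddfD; exact: (@add_row_mx R 1 1 m). Qed.

Lemma row_mxP1 m (v : 'rV[R]_(m.+1)) :
  exists s (w : 'rV[R]_m), v = row_mx s%:M w.
Proof.
exists (v ord0 ord0), (@rsubmx _ 1 1 m v).
rewrite -{1}[v](@hsubmxK R 1 1 m v); congr (@row_mx _ 1 1 m _ _).
apply/matrixP => i j; rewrite !ord1 !mxE eqxx mulr1n; congr (v _ _); exact/val_inj.
Qed.

Lemma leb_shift n (v : 'rV[R]_n) (A : set 'rV[R]_n) : measurable A ->
  leb ((fun x => x + v) @^-1` A) = leb A.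
Proof.
elim: n v A => [|m IH] v A mA.
  by congr leb; apply/seteqP; split => x /=; rewrite (thinmx0 v) addr0.
have [s0 [w vE]] := row_mxP1 v; rewrite !leb_cons /product_measure1.
pose g s := leb (xsection (cons_pre A) s).
have mg : measurable_fun [set: T] g.
  by apply: measurable_fun_xsection; exact: measurable_cons_pre.
(* The induction hypothesis absorbs the shift by [w] inside each section; what remains is a change
   of variable on the line. *)
rewrite [LHS](_ : _ = \int[@lebesgue_measure R]_s g (s + s0)%R)%E; last first.
  apply: eq_integral => s _ /=; rewrite -[RHS](IH w); last first.
    by apply: measurable_xsection; exact: measurable_cons_pre.
  congr leb; apply/seteqP; split => y /=;
  by rewrite /xsection/= /cons_pre/= !inE/= vE row_mxD1.
have mf : measurable_fun setT (fun x : T => x + s0 : T).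
  exact: measurable_funD.
rewrite -(@ge0_integral_pushforward _ _ T T R _ mf lebesgue_measure setT g)//=.
by apply: eq_measure_integral => //= B mB _; exact: lebesgue_measure_shift.
Qed.

End measurable_rV_lemmas.

Section sup_norm.
Context {R : realType} {n : nat}.
Implicit Types x : 'rV[R]_n.

Lemma normr_coord_le x i : `|x ord0 i| <= `|x|.
Proof.
rewrite [leRHS]/Num.Def.normr /= mx_normrE; apply/bigmax_geP; right => /=.
by exists (ord0, i).
Qed.

Lemma normr_rV_le x r : 0 <= r -> (forall i, `|x ord0 i| <= r) -> `|x| <= r.
Proof.
move=> r0 xr; rewrite [leLHS]/Num.Def.normr /= mx_normrE; apply/bigmax_leP;
  split => //.
by move=> [i j] _ /=; rewrite ord1.
Qed.

Lemma normr_rV_lt x r : 0 < r -> (forall i, `|x ord0 i| < r) -> `|x| < r.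
Proof.
move=> r0 xr; rewrite [ltLHS]/Num.Def.normr /= mx_normrE; apply/bigmax_ltP;
  split => //.
by move=> [i j] _ /=; rewrite ord1.
Qed.

End sup_norm.

(** * Measurability of open and compact sets, volume of cubes *)

Section topology_measurability.
Context {R : realType}.
Local Notation T := (measurableTypeR R).

(** The sigma-algebra is a product one, not Borel by definition. An open set is the union of the
    boxes with rational centre and radius that it contains, and there are countably many of them. *)
Lemma open_measurable_rV n (U : set 'rV[R]_n) : open U -> measurable U.
Proof.
move=> oU.
pose O (p : 'rV[rat]_n * rat) : set 'rV[R]_n :=
  [set x | forall i, `|x ord0 i - ratr (p.1 ord0 i)| < ratr p.2].
have mO p : measurable (O p).
  rewrite (_ : O p = \bigcap_(i in [set: 'I_n])
      ((fun x : 'rV[R]_n => x ord0 i : T) @^-1`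
        (ball (ratr (p.1 ord0 i) : R) (ratr p.2)))).
    apply: fin_bigcap_measurable => // i _.
    rewrite -[X in measurable X]setTI; apply: measurable_coord => //.
    exact: measurable_ball.
  apply/seteqP; split => x Ox i; have := Ox i; rewrite /ball/= ?/ball_ distrC //.
  by move=> /(_ I).
rewrite (_ : U = \bigcup_(p in [set: 'rV[rat]_n * rat])
    (if `[< O p `<=` U >] then O p else set0)); last first.
  apply/seteqP; split => [x Ux|x [p _]]; last by case: asboolP => // /[apply].
  have /nbhs_ballP[e /= e0 xeU] : nbhs x U by exact: open_nbhs_nbhs.
  have [r] : exists r : rat, ratr r \in `]0 : R, e / 2[.
    by apply: rat_in_itvoo; rewrite divr_gt0.
  rewrite in_itv/= => /andP[r0 re].
  have xq i : exists q : rat, ratr q \in `]x ord0 i - ratr r, x ord0 i + ratr r[.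
    by apply: rat_in_itvoo; rewrite ltrBlDr -addrA ltrDl addr_gt0.
  have Op : O (\row_i projT1 (cid (xq i)), r) x.
    move=> i /=; rewrite mxE; case: cid => q /=; rewrite in_itv/= => /andP[? ?].
    by rewrite ltr_distlC !lterBDr; lra.
  exists (\row_i projT1 (cid (xq i)), r) => //; case: asboolP => // -[].
  move=> y Oy; apply: xeU; rewrite -ball_normE /ball_/=.
  apply: normr_rV_lt => // i; have := Oy i; have := Op i; rewrite !mxE /=.
  set q := ratr _ => xq' yq'; rewrite -(subrK q (x ord0 i)) -addrA.
  by rewrite (le_lt_trans (ler_normD _ _))// [`|q - _|]distrC; lra.
apply: countable_bigcupT_measurable => [|p]; first exact: countableP.
by case: asboolP.
Qed.

Lemma closed_measurable_rV n (A : set 'rV[R]_n) : closed A -> measurable A.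
Proof.
move=> cA; rewrite -[A]setCK; apply: measurableC; apply: open_measurable_rV.
exact: closed_openC.
Qed.

Lemma compact_measurable_rV n (A : set 'rV[R]_n) : compact A -> measurable A.
Proof.
by move=> cA; apply: closed_measurable_rV; apply: compact_closed.
Qed.

Definition cube n (r : R) : set 'rV[R]_n := [set x | forall i, `|x ord0 i| <= r].

Lemma measurable_cube n r : measurable (@cube n r).
Proof.
rewrite (_ : @cube n r = \bigcap_(i in [set: 'I_n])
    ((fun x : 'rV[R]_n => x ord0 i : T) @^-1` `[- r, r]%classic)).
  apply: fin_bigcap_measurable => // i _.
  by rewrite -[X in measurable X]setTI; apply: measurable_coord.
apply/seteqP; split => x Ox i; have := Ox i; rewrite /= in_itv/= -ler_norml//.
by move=> /(_ I).
Qed.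

Lemma leb_cube n r : 0 <= r -> leb (@cube n r) = ((r *+ 2) ^+ n)%:E.
Proof.
move=> r0; elim: n => [|m IH].
  rewrite expr0 /leb /= diracE mem_set//.
  by case.
rewrite leb_cons (_ : cons_pre _ = `[- r, r]%classic `*` @cube m r).
  rewrite product_measure1E//; last exact: measurable_cube.
  rewrite /= IH lebesgue_measure_itv/= lte_fin.
  case: ifPn => [_|]; first by rewrite -EFinB opprK -mulr2n -EFinM exprS.
  by rewrite -leNgt => r0'; rewrite (_ : r = 0) ?mul0rn ?expr0n/= ?mul0e//; lra.
apply/seteqP; split => -[s y]/=.
  move=> sy; split.
    by have := sy ord0; rewrite /= row_mx_ord0 in_itv/= ler_norml.
  by move=> i; have := sy (lift ord0 i); rewrite /= row_mx_lift.
move=> []; rewrite in_itv/= -ler_norml => sr yr i.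
by case: (unliftP ord0 i) => [j ->|->]; rewrite /= ?row_mx_lift ?row_mx_ord0.
Qed.

End topology_measurability.

(** * Invariance under isometries and dilations *)

Section invariance.
Context {R : realType}.
Local Notation T := (measurableTypeR R).

Section uniqueness.
Variables (n : nat) (mu : {sigma_finite_measure set 'rV[R]_n -> \bar R}).
Hypothesis mu_shift : forall v (A : set 'rV[R]_n), measurable A ->
  mu ((fun x => x + v) @^-1` A) = mu A.

(* Fubini applied to the indicator of [x \in A /\ x + y \in B], then to its
   image under the mu-preserving substitution [x := x - y]. *)
Lemma shift_invariant_measure_unique (A B : set 'rV[R]_n) :
  measurable A -> measurable B ->
  (mu A * leb B = mu B * leb (-%R @^-1` A))%E.
Proof.
move=> mA mB.
have mpre (f : 'rV[R]_n * 'rV[R]_n -> 'rV[R]_n) C : measurable_fun setT f ->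
    measurable C -> measurable (f @^-1` C).
  by move=> mf mC; rewrite -[X in measurable X]setTI; exact: mf.
have mN : measurable_fun setT (-%R : 'rV[R]_n -> _).
  apply: measurable_fun_rV => i; under eq_fun do rewrite mxE.
  by apply: measurableT_comp => //; exact: measurable_coord.
pose S : set ('rV[R]_n * 'rV[R]_n) :=
  (fst @^-1` A) `&` ((fun p => p.1 + p.2) @^-1` B).
pose S' : set ('rV[R]_n * 'rV[R]_n) :=
  ((fun p => p.1 - p.2) @^-1` A) `&` (fst @^-1` B).
have mS : measurable S.
  apply: measurableI; apply: mpre => //; exact: measurable_fun_rVD.
have mS' : measurable S'.
  apply: measurableI; apply: mpre => //; apply: measurable_fun_rVD => //.
  exact: measurableT_comp.
have pE C : measurable C -> (mu \x leb)%E C = (mu \x^ leb)%E C.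
  move=> mC; apply: product_measure_unique => // D D' mD mD'.
  exact: product_measure2E.
transitivity ((mu \x leb)%E S).
  rewrite /product_measure1 (eq_integral (fun x => (\1_A x)%:E * leb B)%E).
    by rewrite ge0_integralZr ?integral_indic ?setIT//; exact: measurableT_comp.
  move=> x _ /=; rewrite indicE; have [xA|xA] := boolP (x \in A).
    rewrite mul1e -(leb_shift x mB); congr leb.
    apply/seteqP; split => y; rewrite /xsection/= inE /S /= (addrC y).
      by case.
    by move=> ?; split => //; rewrite inE in xA.
  rewrite mul0e (_ : xsection _ _ = set0) ?measure0//.
  apply/seteqP; split => y //; rewrite /xsection/= inE => -[/= Ax _].
  by rewrite notin_setE in xA.
rewrite pE// [RHS](_ : _ = (mu \x leb)%E S').
  rewrite pE // /product_measure2; apply: eq_integral => y _ /=.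
  rewrite -[LHS](mu_shift (- y)); last exact: measurable_ysection.
  by congr (mu _); apply/seteqP; split => x;
    rewrite /ysection/= !inE /S /S' /= subrK.
rewrite /product_measure1 (eq_integral (fun x => (\1_B x)%:E * leb (-%R @^-1`
  A))%E).
  by rewrite ge0_integralZr ?integral_indic ?setIT//; exact: measurableT_comp.
have mNA : measurable (-%R @^-1` A).
  by rewrite -[X in measurable X]setTI; exact: mN.
move=> x _ /=; rewrite indicE; have [xB|xB] := boolP (x \in B).
  rewrite mul1e -(leb_shift (- x) mNA); congr leb.
  apply/seteqP; split => y; rewrite /xsection/= inE /S' /= opprB.
    by case.
  by move=> ?; split => //; rewrite inE in xB.
rewrite mul0e (_ : xsection _ _ = set0) ?measure0//.
apply/seteqP; split => y //; rewrite /xsection/= inE => -[/= _ Bx].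
by rewrite notin_setE in xB.
Qed.

End uniqueness.

(** The image of [leb] under [g] is translation invariant because [f] is additive, hence
    proportional to [leb]. Proportionality is written by cross-multiplication with a test set [A],
    symmetric so that the reflection in the uniqueness lemma disappears; the factor can then be read
    off from one set of known volume, without determinants. *)
Lemma leb_linear_preimage n (f g : 'rV[R]_n -> 'rV[R]_n) (A B : set 'rV[R]_n) :
  measurable_fun setT f -> measurable_fun setT g -> cancel f g -> cancel g f ->
  {morph f : x y / x + y} ->
  measurable A -> measurable B -> (forall x, A x -> A (- x)) ->
  (leb (f @^-1` A) * leb B = leb (f @^-1` B) * leb A)%E.
Proof.
move=> mf mg fK gK fD mA mB sA.
pose nu := fun C : set 'rV[R]_n => leb (f @^-1` C).
have mpre C : measurable C -> measurable (f @^-1` C).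
  by move=> mC; rewrite -[X in measurable X]setTI; exact: mf.
have nu0 : nu set0 = 0%E by rewrite /nu preimage_set0 measure0.
have nu_ge0 C : (0 <= nu C)%E by exact: measure_ge0.
have nu_add : semi_sigma_additive nu.
  move=> F mF tF mUF; rewrite /nu preimage_bigcup.
  apply: measure_semi_sigma_additive.
  - by move=> i; exact: mpre.
  - apply/trivIsetP => i j _ _ ij; rewrite -preimage_setI.
    by move/trivIsetP : tF => /(_ _ _ _ _ ij) ->//; rewrite preimage_set0.
  - by rewrite -preimage_bigcup; exact: mpre.
have nu_sf : sigma_finite setT nu.
  have [F FT Ffin] := sigma_finiteT (@leb R n).
  exists (fun k => g @^-1` F k);
    first by rewrite -preimage_bigcup -FT preimage_setT.
  move=> k; have [mF Foo] := Ffin k; split.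
    by rewrite -[X in measurable X]setTI; exact: mg.
  rewrite /nu -comp_preimage (_ : g \o f = id) ?preimage_id//.
  by apply/funext => x /=; rewrite fK.
have nu_shift (v : 'rV[R]_n) (C : set 'rV[R]_n) : measurable C ->
    nu ((fun x => x + v) @^-1` C) = nu C.
  move=> mC; rewrite /nu -(leb_shift (g v) (mpre _ mC)); congr leb.
  by apply/seteqP; split => x /=; rewrite fD gK.
have nuE C : leb (f @^-1` C) = nu C by [].
rewrite !nuE; clearbody nu.
pose m := isMeasure.Build _ _ _ nu nu0 nu_ge0 nu_add.
pose s := Measure_isSigmaFinite.Build _ _ _
  (HB.pack_for {measure set 'rV[R]_n -> \bar R} nu m) nu_sf.
pose mu := HB.pack_for {sigma_finite_measure set 'rV[R]_n -> \bar R} nu m s.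
rewrite (@shift_invariant_measure_unique n mu nu_shift A B mA mB).
congr (_ * leb _)%E; apply/seteqP; split => x /=; last exact: sA.
by move=> /sA; rewrite opprK.
Qed.

Lemma muleI_fin (r : R) (x y : \bar R) : r != 0 ->
  (r%:E * x = y * r%:E)%E -> x = y.
Proof.
move=> r0 /(congr1 (fun z => (r^-1)%:E * z)%E).
by rewrite [(y * _)%E]muleC !muleA -EFinM mulVf// !mul1e.
Qed.

Lemma dotvE n (x y : 'rV[R]_n) : dotv x y = (x *m y^T) ord0 ord0.
Proof. by rewrite /dotv mxE; apply: eq_bigr => i _; rewrite mxE. Qed.

Lemma dotvC n (x y : 'rV[R]_n) : dotv x y = dotv y x.
Proof. by apply: eq_bigr => i _; rewrite mulrC. Qed.

Lemma dotvDl n (x y z : 'rV[R]_n) : dotv (x + y) z = dotv x z + dotv y z.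
Proof. by rewrite !dotvE mulmxDl mxE. Qed.

Lemma dotvZl n (a : R) (x z : 'rV[R]_n) : dotv (a *: x) z = a * dotv x z.
Proof. by rewrite !dotvE -scalemxAl mxE. Qed.

Lemma dotvDr n (x y z : 'rV[R]_n) : dotv z (x + y) = dotv z x + dotv z y.
Proof. by rewrite dotvC dotvDl !(dotvC z). Qed.

Lemma dotvZr n (a : R) (x z : 'rV[R]_n) : dotv z (a *: x) = a * dotv z x.
Proof. by rewrite dotvC dotvZl dotvC. Qed.

Lemma dotvNl n (x z : 'rV[R]_n) : dotv (- x) z = - dotv x z.
Proof. by rewrite -scaleN1r dotvZl mulN1r. Qed.

Lemma dotvNr n (x z : 'rV[R]_n) : dotv z (- x) = - dotv z x.
Proof. by rewrite dotvC dotvNl dotvC. Qed.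

Lemma dotv0l n (z : 'rV[R]_n) : dotv 0 z = 0.
Proof. by rewrite -(scale0r (0 : 'rV_n)) dotvZl mul0r. Qed.

Lemma dotv0r n (z : 'rV[R]_n) : dotv z 0 = 0.
Proof. by rewrite dotvC dotv0l. Qed.

Lemma dotvv_ge0 n (x : 'rV[R]_n) : 0 <= dotv x x.
Proof. by apply: sumr_ge0 => i _; rewrite -expr2 sqr_ge0. Qed.

Lemma dotvv_eq0 n (x : 'rV[R]_n) : dotv x x = 0 -> x = 0.
Proof.
move/eqP; rewrite psumr_eq0 => [/allP x0|i _]; last by rewrite -expr2 sqr_ge0.
apply/rowP => i; apply/eqP; rewrite mxE.
by have := x0 i (mem_index_enum i); rewrite mulf_eq0 orbb.
Qed.

Lemma dotvv_gt0 n (x : 'rV[R]_n) : x != 0 -> 0 < dotv x x.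
Proof.
by move=> x0; rewrite lt_neqAle dotvv_ge0 andbT eq_sym;
  apply: contraNneq x0 => /dotvv_eq0->.
Qed.

Lemma enorm_ge0 n (x : 'rV[R]_n) : 0 <= enorm x.
Proof. exact: sqrtr_ge0. Qed.

Lemma enorm_sqr n (x : 'rV[R]_n) : enorm x ^+ 2 = dotv x x.
Proof. by rewrite sqr_sqrtr ?dotvv_ge0. Qed.

Lemma enorm_le n (x : 'rV[R]_n) r : 0 <= r -> (enorm x <= r) = (dotv x x <= r ^+ 2).
Proof. by move=> r0; rewrite -enorm_sqr ler_sqr// nnegrE enorm_ge0. Qed.

Lemma enormZ n (a : R) (x : 'rV[R]_n) : enorm (a *: x) = `|a| * enorm x.
Proof. by rewrite /enorm dotvZl dotvZr mulrA -expr2 sqrtrM ?sqr_ge0// sqrtr_sqr.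
  Qed.

Lemma enorm_gt0 n (x : 'rV[R]_n) : x != 0 -> 0 < enorm x.
Proof. by move=> x0; rewrite sqrtr_gt0 dotvv_gt0. Qed.

Lemma coord_le_enorm n (x : 'rV[R]_n) i : `|x ord0 i| <= enorm x.
Proof.
rewrite -(@ler_pXn2r _ 2) ?nnegrE ?enorm_ge0// enorm_sqr /dotv (bigD1 i)//=.
by rewrite real_normK ?num_real// expr2 lerDl; apply: sumr_ge0 => j _;
  rewrite -expr2 sqr_ge0.
Qed.

Lemma measurable_dotv d (U : measurableType d) n (f g : U -> 'rV[R]_n) :
  measurable_fun setT f -> measurable_fun setT g ->
  measurable_fun setT (fun u => dotv (f u) (g u) : T).
Proof.
move=> mf mg; apply: measurable_sum => i; apply: measurable_funM.
- exact: (measurableT_comp (measurable_coord i)).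
- exact: (measurableT_comp (measurable_coord i)).
Qed.

Lemma eballE n : @eball R n = [set x | dotv x x <= 1].
Proof. by apply/seteqP; split => x; rewrite /eball/= enorm_le// expr1n. Qed.

Lemma measurable_eball n : measurable (@eball R n).
Proof.
rewrite eballE (_ : mkset _ = (fun x => dotv x x : T) @^-1` `]-oo, 1]%classic).
  rewrite -[X in measurable X]setTI; apply: measurable_dotv => //.
by apply/seteqP; split => x /=; rewrite in_itv.
Qed.

Lemma cube_sub_eball n : cube n.+1%:R^-1 `<=` @eball R n.
Proof.
(* Any radius with n r^2 <= 1 works; [n.+1] also keeps it positive in dimension 0. *)
set r : R := n.+1%:R^-1; have r0 : 0 < r by rewrite invr_gt0.
move=> x xr; rewrite eballE /=.
apply: (@le_trans _ _ (\sum_(i < n) r ^+ 2)).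
  apply: ler_sum => i _; rewrite -expr2 -real_normK ?num_real//.
  by rewrite ler_sqr ?nnegrE// ?ltW.
rewrite sumr_const card_ord -mulr_natr expr2 -mulrA.
have rn : r * n%:R <= 1 by rewrite /r mulrC ler_pdivrMr// mul1r ler_nat.
have r1 : r <= 1 by rewrite invf_le1// ler1n.
by apply: mulr_ile1 => //; rewrite ?mulr_ge0// ltW.
Qed.

Lemma leb_eball n : exists2 r : R, 0 < r & leb (@eball R n) = r%:E.
Proof.
have fin : (leb (@eball R n) < +oo)%E.
  apply: (@le_lt_trans _ _ (leb (@cube R n 1))); last by rewrite leb_cube ?ltry.
  apply: le_measure; rewrite ?inE//;
    [exact: measurable_eball|exact: measurable_cube|].
  by move=> x /= x1 i; apply: le_trans x1; exact: coord_le_enorm.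
have gt0 : (0 < leb (@eball R n))%E.
  apply: (@lt_le_trans _ _ (leb (@cube R n n.+1%:R^-1))).
    by rewrite leb_cube ?invr_ge0// lte_fin exprn_gt0// pmulrn_lgt0// invr_gt0.
  apply: le_measure; rewrite ?inE//;
    [exact: measurable_cube|exact: measurable_eball|].
  exact: cube_sub_eball.
exists (fine (leb (@eball R n))); last by rewrite fineK// gt0_fin_numE.
by rewrite fine_gt0// gt0.
Qed.

(** The test set is the Euclidean ball, which [Q] preserves, so the factor is 1. *)
Lemma leb_orthogonal n (Q : 'M[R]_n) (B : set 'rV[R]_n) : Q *m Q^T = 1%:M ->
  measurable B -> leb ((fun x => x *m Q) @^-1` B) = leb B.
Proof.
move=> QQ mB; have QQ' := mulmx1C QQ; have [r r0 rE] := leb_eball n.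
have mQ (P : 'M[R]_n) : measurable_fun setT (fun x : 'rV[R]_n => x *m P).
  exact: measurable_fun_rV_mulmx.
have := @leb_linear_preimage n (fun x => x *m Q) (fun x => x *m Q^T) (@eball R n) B
  (mQ _) (mQ _).
rewrite (_ : _ @^-1` eball n = eball n) ?rE; last first.
  rewrite eballE; apply/seteqP; split => x /=;
  by rewrite !dotvE trmx_mul mulmxA -(mulmxA x) QQ mulmx1.
move=> H; apply/esym/(@muleI_fin r); first by rewrite gt_eqF.
rewrite H//.
- by move=> x; rewrite -mulmxA QQ mulmx1.
- by move=> x; rewrite -mulmxA QQ' mulmx1.
- by move=> x y; rewrite mulmxDl.
- exact: measurable_eball.
- by move=> x; rewrite eballE /= dotvNl dotvNr opprK.
Qed.

(** The test set is a cube: its dilates are cubes, whose volumes are known. *)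
Lemma leb_scale n (c : R) (B : set 'rV[R]_n) : 0 < c -> measurable B ->
  leb ((fun x => c^-1 *: x) @^-1` B) = ((c ^+ n)%:E * leb B)%E.
Proof.
move=> c0 mB.
have mZ (a : R) : measurable_fun setT (fun x : 'rV[R]_n => a *: x).
  apply: measurable_fun_rV => i; under eq_fun do rewrite mxE.
  by apply: measurable_funM => //; exact: measurable_coord.
have := @leb_linear_preimage n (fun x => c^-1 *: x) (fun x => c *: x) (@cube R n
  1) B
  (mZ _) (mZ _).
rewrite (_ : _ @^-1` cube 1 = cube c); last first.
  apply/seteqP; split => x /= xc i; have := xc i;
    rewrite mxE normrM gtr0_norm ?invr_gt0//;
  by rewrite mulrC ler_pdivrMr// mul1r.
rewrite !leb_cube ?ltW// => H.
apply: (@muleI_fin ((1 *+ 2) ^+ n)); first by rewrite expf_neq0.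
rewrite muleC -H.
- by rewrite [RHS]muleAC -EFinM -exprMn mulrnAr mulr1.
- by move=> x; rewrite scalerA mulfV ?scale1r// gt_eqF.
- by move=> x; rewrite scalerA mulVf ?scale1r// gt_eqF.
- by move=> x y; rewrite scalerDr.
- exact: measurable_cube.
- exact: mB.
- by move=> x xr i; rewrite mxE normrN.
Qed.

End invariance.

(** * Minkowski sums and volume *)

Section continuity.
Context {R : realType} (U : topologicalType).

Lemma continuous_rV n (f : U -> 'rV[R]_n) :
  (forall i, continuous (fun u => f u ord0 i)) -> continuous f.
Proof.
move=> cf u A [P uP PA]; rewrite /nbhs/=.
have : \forall v \near u, forall ij : 'I_1 * 'I_n, P ij.1 ij.2 (f v ij.1 ij.2).
  apply: filter_forall => -[i j] /=; rewrite (ord1 i).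
  by apply: cf; exact: uP.
by apply: filterS => v Pv; apply: PA => i j; exact: (Pv (i, j)).
Qed.

Lemma continuous_rV_coord n (f : U -> 'rV[R]_n) i :
  continuous f -> continuous (fun u => f u ord0 i).
Proof.
move=> cf u; apply: (@continuous_comp _ _ _ f (fun x : 'rV[R]_n => x ord0 i)).
  exact: cf.
exact: coord_continuous.
Qed.

Lemma continuous_sumR (I : Type) (r : seq I) (F : I -> U -> R) :
  (forall i, continuous (F i)) -> continuous (fun u => \sum_(i <- r) F i u).
Proof.
move=> cF; elim: r => [|i r IH].
  by under eq_fun do rewrite big_nil; exact: cst_continuous.
under eq_fun do rewrite big_cons.
by move=> u; apply: continuousD; [exact: cF|exact: IH].
Qed.

Lemma continuous_dotv n (f g : U -> 'rV[R]_n) : continuous f -> continuous g ->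
  continuous (fun u => dotv (f u) (g u)).
Proof.
move=> cf cg; apply: continuous_sumR => i u.
by apply: continuousM; apply: continuous_rV_coord.
Qed.

Lemma continuous_rVD n (f g : U -> 'rV[R]_n) : continuous f -> continuous g ->
  continuous (fun u => f u + g u).
Proof. by move=> cf cg u; apply: continuousD; [exact: cf|exact: cg]. Qed.

Lemma continuous_rVZ n (k : U -> R) (f : U -> 'rV[R]_n) : continuous k ->
  continuous f -> continuous (fun u => k u *: f u).
Proof. by move=> cf cg u; apply: continuousZ; [exact: cf|exact: cg]. Qed.

Lemma continuous_rV_mulmx n m (f : U -> 'rV[R]_n) (Q : 'M[R]_(n, m)) :
  continuous f -> continuous (fun u => f u *m Q).
Proof.
move=> cf; apply: continuous_rV => i; under eq_fun do rewrite mxE.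
apply: continuous_sumR => j u; apply: continuousM; last exact: cst_continuous.
exact: continuous_rV_coord.
Qed.

End continuity.

Section minkowski_sum.
Context {R : realType} {n : nat}.
Implicit Types (A B : set 'rV[R]_n) (x y z : 'rV[R]_n).

Definition mink_sum A B := [set x + y | x in A & y in B].
Definition dilate (c : R) A := [set c *: x | x in A].
Definition seg z := [set t *: z | t in `[0, 1]%classic].
Definition convex A := forall x y (t : R), A x -> A y -> 0 <= t <= 1 ->
  A (t *: x + (1 - t) *: y).

Lemma mink_sum_compact A B : compact A -> compact B -> compact (mink_sum A B).
Proof.
move=> cA cB.
rewrite (_ : mink_sum A B = (fun p => p.1 + p.2) @` (A `*` B)).
  apply: continuous_compact; last exact: compact_setX.
  apply: continuous_subspaceT; apply: continuous_rVD.
    by move=> u; exact: cvg_fst.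
  by move=> u; exact: cvg_snd.
apply/seteqP; split => [_ [x Ax [y By <-]]|_ [[x y] [Ax By] <-]].
  by exists (x, y).
by exists x => //; exists y.
Qed.

Lemma dilate_compact c A : compact A -> compact (dilate c A).
Proof.
move=> cA; apply: continuous_compact => //; apply: continuous_subspaceT.
apply: continuous_rVZ; first exact: cst_continuous.
by move=> u; exact: cvg_id.
Qed.

Lemma seg_compact z : compact (seg z).
Proof.
apply: continuous_compact; last exact: segment_compact.
apply: continuous_subspaceT.
apply: continuous_rVZ; last exact: cst_continuous.
by move=> u; exact: cvg_id.
Qed.

Lemma mink_sum_convex A B : convex A -> convex B -> convex (mink_sum A B).
Proof.
move=> cA cB _ _ t [x Ax [y By <-]] [x' Ax' [y' By' <-]] t01.
exists (t *: x + (1 - t) *: x'); first exact: cA.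
exists (t *: y + (1 - t) *: y'); first exact: cB.
by rewrite !scalerDr addrACA.
Qed.

Lemma dilate_convex c A : convex A -> convex (dilate c A).
Proof.
move=> cA _ _ t [x Ax <-] [y Ay <-] t01.
exists (t *: x + (1 - t) *: y); first exact: cA.
by rewrite scalerDr !scalerA ![_ * c]mulrC.
Qed.

Lemma seg_convex z : convex (seg z).
Proof.
move=> _ _ t [a + <-] [b + <-] /andP[t0 t1];
  rewrite /= !in_itv/= => /andP[? ?] /andP[? ?].
exists (t * a + (1 - t) * b); last by rewrite !scalerA scalerDl.
by rewrite /= in_itv/=; apply/andP; split; nra.
Qed.

Lemma convex_set_convex A :
  convex_set (A : set (convex_lmodType 'rV[R]_n)) -> convex A.
Proof.
move=> cA x y t Ax Ay /andP[t0 t1].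
by have := cA x y (Itv01 t0 t1); rewrite !inE; apply.
Qed.

Lemma mink_sumS A B A' B' : A `<=` A' -> B `<=` B' ->
  mink_sum A B `<=` mink_sum A' B'.
Proof.
by move=> AA BB _ [x Ax [y By <-]]; exists x; [exact: AA|exists y => //; exact: BB].
Qed.

Lemma mink_sumA A B C : mink_sum A (mink_sum B C) = mink_sum (mink_sum A B) C.
Proof.
apply/seteqP; split.
  move=> _ [x Ax [_ [y By [z Cz <-]] <-]]; exists (x + y);
    first by exists x => //; exists y.
  by exists z => //; rewrite addrA.
move=> _ [_ [x Ax [y By <-]] [z Cz <-]]; exists x => //; exists (y + z).
  by exists y => //; exists z.
by rewrite addrA.
Qed.

Lemma mink_sumC A B : mink_sum A B = mink_sum B A.
Proof.
by apply/seteqP; split => _ [x Ax [y By <-]]; exists y => //; exists x => //;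
  rewrite addrC.
Qed.

Lemma mink_sum0 A : mink_sum A [set 0] = A.
Proof.
apply/seteqP; split=> [_ [x Ax [_ -> <-]]|x Ax]; first by rewrite addr0.
by exists x => //; exists 0; rewrite ?addr0.
Qed.

Lemma mink_sum_scale A (a b : R) : convex A -> 0 < a -> 0 < b ->
  mink_sum (dilate a A) (dilate b A) = dilate (a + b) A.
Proof.
move=> cA a0 b0; have ab : 0 < a + b by rewrite addr_gt0.
apply/seteqP; split=> [_ [_ [x Ax <-] [_ [y Ay <-] <-]]|_ [x Ax <-]]; last first.
  by exists (a *: x); [exists x|exists (b *: x); [exists x|rewrite scalerDl]].
exists (a / (a + b) *: x + (1 - a / (a + b)) *: y).
  by apply: cA => //; rewrite divr_ge0 ?(ltW a0) ?(ltW ab)//= ler_pdivrMr// mul1r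
    lerDl ltW.
rewrite scalerDr !scalerA; congr (_ *: _ + _ *: _).
  by rewrite mulrC divfK// gt_eqF.
by rewrite mulrBr mulr1 mulrC divfK ?gt_eqF// addrC addKr.
Qed.

Lemma dilateE c A : c != 0 -> dilate c A = (fun x => c^-1 *: x) @^-1` A.
Proof.
move=> c0; apply/seteqP; split=> [_ [x Ax <-]|x Ax].
  by rewrite /= scalerA mulVf// scale1r.
by exists (c^-1 *: x) => //; rewrite scalerA mulfV// scale1r.
Qed.

Lemma dilate1 A : dilate 1 A = A.
Proof.
by apply/seteqP; split=> [_ [x Ax <-]|x Ax]; [rewrite scale1r|exists x;
  rewrite ?scale1r].
Qed.

Lemma dilateA a b A : dilate a (dilate b A) = dilate (a * b) A.
Proof.
apply/seteqP; split=> [_ [_ [x Ax <-] <-]|_ [x Ax <-]].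
  by exists x => //; rewrite scalerA.
by exists (b *: x); [exists x|rewrite scalerA].
Qed.

Lemma dilate_mink_sum c A B : dilate c (mink_sum A B) = mink_sum (dilate c A)
  (dilate c B).
Proof.
apply/seteqP; split=> [_ [_ [x Ax [y By <-]] <-]|_ [_ [x Ax <-] [_ [y By <-] <-]]].
  by exists (c *: x); [exists x|exists (c *: y); [exists y|rewrite scalerDr]].
by exists (x + y); [exists x => //; exists y|rewrite scalerDr].
Qed.

Lemma dilate_seg c z : dilate c (seg z) = seg (c *: z).
Proof.
apply/seteqP; split=> [_ [_ [t t01 <-] <-]|_ [t t01 <-]].
  by exists t => //; rewrite !scalerA mulrC.
by exists (t *: z); [exists t|rewrite !scalerA mulrC].
Qed.

Lemma dilateS c A B : A `<=` B -> dilate c A `<=` dilate c B.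
Proof. by move=> AB _ [x Ax <-]; exists x => //; exact: AB. Qed.

Lemma seg0 z : seg z 0.
Proof. by exists 0; rewrite /= ?in_itv/= ?lexx ?ler01 ?scale0r. Qed.

Lemma seg1 z : seg z z.
Proof. by exists 1; rewrite /= ?in_itv/= ?lexx ?ler01 ?scale1r. Qed.

End minkowski_sum.

Section volume.
Context {R : realType}.

(** [volume] goes through [fine], which sends an infinite measure to 0. On these sets it is
    faithful, and inequalities and additivity pass from [leb] to real numbers. *)
Definition bmeas n (A : set 'rV[R]_n) := measurable A /\ exists r, A `<=` cube r.

Lemma compact_bmeas n (A : set 'rV[R]_n) : compact A -> bmeas A.
Proof.
move=> cA; split; first exact: compact_measurable_rV.
have [M [_ AM]] := compact_bounded cA; exists (`|M| + 1) => x Ax i.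
apply: le_trans (normr_coord_le _ _) _.
by apply: AM => //; rewrite ltr_pwDr// ler_norm.
Qed.

Lemma bmeas_sub n (A B : set 'rV[R]_n) :
  measurable A -> A `<=` B -> bmeas B -> bmeas A.
Proof. by move=> mA AB [_ [r Br]]; split => //; exists r;
  exact: subset_trans Br. Qed.

Lemma bmeas_leb n (A : set 'rV[R]_n) : bmeas A -> leb A = (volume A)%:E.
Proof.
move=> [mA [r Ar]]; rewrite /volume -/(leb A) fineK// ge0_fin_numE//.
apply: (@le_lt_trans _ _ (leb (@cube R n `|r|))); last by rewrite leb_cube ?ltry.
apply: le_measure; rewrite ?inE//; first exact: measurable_cube.
by move=> x Ax i; apply: le_trans (Ar _ Ax i) _; exact: ler_norm.
Qed.

Lemma volume_ge0 n (A : set 'rV[R]_n) : 0 <= volume A.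
Proof. by rewrite /volume fine_ge0. Qed.

Lemma le_volume n (A B : set 'rV[R]_n) :
  measurable A -> bmeas B -> A `<=` B -> volume A <= volume B.
Proof.
move=> mA bB AB; rewrite -lee_fin -!bmeas_leb//; last exact: bmeas_sub bB.
by apply: le_measure; rewrite ?inE//; case: bB.
Qed.

Lemma bmeasU n (A B : set 'rV[R]_n) : bmeas A -> bmeas B -> bmeas (A `|` B).
Proof.
move=> [mA [r Ar]] [mB [s Bs]]; split; first exact: measurableU.
by exists (Num.max r s) => x [/Ar|/Bs] xr i; rewrite le_max xr ?orbT.
Qed.

Lemma bmeas0 n : bmeas (set0 : set 'rV[R]_n).
Proof. by split => //; exists 0. Qed.

Lemma volume0 n : volume (set0 : set 'rV[R]_n) = 0.
Proof. by rewrite /volume -/(leb set0) measure0. Qed.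

Lemma volumeU n (A B : set 'rV[R]_n) : bmeas A -> bmeas B ->
  A `&` B = set0 -> volume (A `|` B) = volume A + volume B.
Proof.
move=> bA bB AB; apply: EFin_inj; rewrite EFinD -!bmeas_leb//; last exact: bmeasU.
by apply: measureU => //; [case: bA|case: bB].
Qed.

Lemma le_volumeU n (A B : set 'rV[R]_n) : bmeas A -> bmeas B ->
  volume (A `|` B) <= volume A + volume B.
Proof.
move=> bA bB; rewrite -lee_fin EFinD -!bmeas_leb//; last exact: bmeasU.
by apply: measureU2; [case: bA|case: bB].
Qed.

Lemma bmeas_bigU n (I : Type) (s : seq I) (F : I -> set 'rV[R]_n) :
  (forall i, bmeas (F i)) -> bmeas (\big[setU/set0]_(i <- s) F i).
Proof. by move=> bF; elim/big_ind: _ => //; [exact: bmeas0|move=> *;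
  exact: bmeasU]. Qed.

Lemma volume_bigU n (I : finType) (F : I -> set 'rV[R]_n) :
  (forall i, bmeas (F i)) -> (forall i j, i != j -> F i `&` F j = set0) ->
  volume (\big[setU/set0]_i F i) = \sum_i volume (F i).
Proof.
move=> bF dF; suff: forall s, uniq s ->
  volume (\big[setU/set0]_(i <- s) F i) = \sum_(i <- s) volume (F i).
  by apply; exact: index_enum_uniq.
elim=> [_|i s IH /= /andP[ins us]]; first by rewrite !big_nil volume0.
rewrite !big_cons volumeU ?IH//; first exact: bmeas_bigU.
apply/seteqP; split => // x [Fix].
rewrite -bigcup_seq => -[j /= js Fjx].
have : i != j by apply: contraNneq ins => ->.
by move=> /dF/seteqP[+ _]; apply; split; [exact: Fix|exact: Fjx].
Qed.

Lemma le_volume_bigU n (I : finType) (F : I -> set 'rV[R]_n) :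
  (forall i, bmeas (F i)) ->
  volume (\big[setU/set0]_i F i) <= \sum_i volume (F i).
Proof.
move=> bF; elim: (index_enum I) => [|i s IH]; first by rewrite !big_nil volume0.
rewrite !big_cons; apply: le_trans (le_volumeU _ _) _ => //;
  first exact: bmeas_bigU.
by rewrite lerD2l.
Qed.

Lemma volume_shift n (v : 'rV[R]_n) (A : set 'rV[R]_n) : measurable A ->
  volume (mink_sum A [set v]) = volume A.
Proof.
move=> mA; rewrite /volume -!/(leb _) (_ : mink_sum A _ = (fun x => x - v) @^-1` A).
  by rewrite leb_shift.
apply/seteqP; split=> [_ [x Ax [_ -> <-]]|x Ax] /=; first by rewrite addrK.
by exists (x - v) => //; exists v => //; rewrite subrK.
Qed.

Lemma measurable_dilate n (c : R) (A : set 'rV[R]_n) : c != 0 -> measurable A ->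
  measurable (dilate c A).
Proof.
move=> c0 mA; rewrite dilateE// -[X in measurable X]setTI.
have : measurable_fun setT (fun x : 'rV[R]_n => c^-1 *: x).
  apply: measurable_fun_rV => i; under eq_fun do rewrite mxE.
  by apply: measurable_funM => //; exact: measurable_coord.
by apply.
Qed.

Lemma bmeas_dilate n (c : R) (A : set 'rV[R]_n) : c != 0 -> bmeas A ->
  bmeas (dilate c A).
Proof.
move=> c0 [mA [r Ar]]; split; first exact: measurable_dilate.
exists (`|c| * r) => _ [x Ax <-] i; rewrite mxE normrM ler_pM2l ?normr_gt0//.
exact: Ar.
Qed.

Lemma volume_dilate n (c : R) (A : set 'rV[R]_n) : 0 < c -> measurable A ->
  volume (dilate c A) = c ^+ n * volume A.
Proof.
move=> c0 mA; rewrite /volume -!/(leb _) dilateE ?gt_eqF// leb_scale//.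
have [/fineK <-|] := boolP (leb A \is a fin_num); first by rewrite -EFinM.
(* If [leb A] is infinite, [fine] turns both sides into 0. *)
rewrite ge0_fin_numE// -leNgt leye_eq => /eqP ->.
by rewrite gt0_muley ?lte_fin ?exprn_gt0// mulr0.
Qed.

End volume.

(** * Adding a segment *)

Section cavalieri.
Context {R : realType} {m : nat}.
Local Notation T := (measurableTypeR R).
Implicit Types (xi : 'rV[R]_(m.+1)) (B : 'M[R]_(m, m.+1)) (A K : set 'rV[R]_(m.+1)).

Definition line_section xi B A (y : 'rV[R]_m) : set T :=
  [set s | A (s *: xi + y *m B)].

(** The orthogonal projection of [A] along [xi], read in the coordinates of the frame [B]. *)
Definition shadow xi B A : set 'rV[R]_m :=
  [set y | exists s, A (s *: xi + y *m B)].

Lemma measurable_line_section xi B A : measurable A ->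
  measurable [set p : T * 'rV[R]_m | A (p.1 *: xi + p.2 *m B)].
Proof.
move=> mA.
suff mf : measurable_fun setT (fun p : T * 'rV[R]_m => p.1 *: xi + p.2 *m B).
  by rewrite -[X in measurable X]setTI; exact: mf.
apply: measurable_fun_rVD; last exact: measurable_fun_rV_mulmx.
apply: measurable_fun_rV => i; under eq_fun do rewrite mxE.
by apply: measurable_funM.
Qed.

Lemma frame_orthogonal xi B : dotv xi xi = 1 -> B *m B^T = 1%:M -> B *m xi^T = 0 ->
  (col_mx xi B : 'M[R]_(m.+1)) *m (col_mx xi B : 'M[R]_(m.+1))^T = 1%:M.
Proof.
move=> xi1 BB Bxi; have -> : (1%:M : 'M[R]_(m.+1)) = (1%:M : 'M[R]_(1 + m)) by [].
rewrite (@tr_col_mx _ 1 m m.+1 xi B) (@mul_col_row _ 1 m m.+1 1 m).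
rewrite scalar_mx_block BB Bxi.
have -> : xi *m xi^T = 1%:M.
  by apply/matrixP => i j; rewrite !ord1 -dotvE xi1 mxE eqxx.
by have -> : xi *m B^T = 0 by rewrite -[LHS]trmxK trmx_mul trmxK Bxi trmx0.
Qed.

(** The matrix with first row [xi] and remaining rows [B] is orthogonal and takes the first axis to
    the direction [xi]. Invariance reduces the claim to Tonelli with the first coordinate integrated
    first. *)
Lemma leb_frame xi B A : dotv xi xi = 1 -> B *m B^T = 1%:M -> B *m xi^T = 0 ->
  measurable A ->
  leb A = (\int[leb]_y lebesgue_measure (line_section xi B A y))%E.
Proof.
move=> xi1 BB Bxi mA.
have mQA : measurable ((fun x : 'rV_m.+1 => x *m (col_mx xi B : 'M[R]_(m.+1)))
  @^-1` A).
  rewrite -[X in measurable X]setTI;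
    have : measurable_fun setT (fun x : 'rV[R]_m.+1 => x *m (col_mx xi B :
      'M[R]_(m.+1))).
    exact: measurable_fun_rV_mulmx.
  by apply.
rewrite -(leb_orthogonal (frame_orthogonal xi1 BB Bxi) mA) leb_cons2//.
rewrite /product_measure2; apply: eq_integral => y _ /=; congr lebesgue_measure.
apply/seteqP; split => s; rewrite /ysection /cons_pre /line_section /= inE /=;
  by rewrite (@mul_row_col _ 1 1 m m.+1) mul_scalar_mx.
Qed.

(** [dotv x xi] attains its extremes on the compact chord, and convexity fills in every value
    between them. *)
Lemma line_section_itv xi B K y : dotv xi xi = 1 -> B *m xi^T = 0 ->
  compact K -> convex K -> shadow xi B K y ->
  exists a b : R, a <= b /\ line_section xi B K y = `[a, b]%classic.
Proof.
move=> xi1 Bxi cK vK [s0 Ks0].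
(* The chord is cut out of [K] by a closed equation on points, so it inherits compactness. *)
pose L : set 'rV[R]_(m.+1) := K `&` [set x | x - dotv x xi *: xi = y *m B].
have dyB s : dotv (s *: xi + y *m B) xi = s.
  rewrite dotvDl dotvZl xi1 mulr1 (_ : dotv (y *m B) xi = 0) ?addr0//.
  by rewrite dotvE -mulmxA Bxi mulmx0 mxE.
have Lline s : K (s *: xi + y *m B) -> L (s *: xi + y *m B).
  by move=> Ks; split => //=; rewrite dyB addrAC subrr add0r.
have L0 : L !=set0 by exists (s0 *: xi + y *m B); exact: Lline.
have cL : compact L.
  apply: compact_closedI; first exact: cK.
  rewrite (_ : mkset _ =
      (fun x : 'rV[R]_m.+1 => x + dotv x (- xi) *: xi) @^-1` [set y *m B]).
    apply: preimage_closed; last first.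
      by apply: compact_closed; [exact: norm_hausdorff|exact: compact_set1].
    move=> x _; apply: continuous_rVD; first by move=> u; exact: cvg_id.
    apply: continuous_rVZ; last exact: cst_continuous.
    apply: continuous_dotv; last exact: cst_continuous.
    by move=> v; exact: cvg_id.
  by apply/seteqP; split => x /=; rewrite dotvNr scaleNr.
have cd : {within L, continuous (fun x => dotv x xi)}.
  apply: continuous_subspaceT; apply: continuous_dotv; last exact: cst_continuous.
  by move=> v; exact: cvg_id.
have LK x : L x -> x = dotv x xi *: xi + y *m B.
  by move=> [_ /= <-]; rewrite addrC subrK.
have [xmax Lmax xmaxP] := EVT_max_rV L0 cL cd.
have [xmin Lmin xminP] := EVT_min_rV L0 cL cd.
rewrite !inE in Lmax Lmin.
exists (dotv xmin xi), (dotv xmax xi); split; first by apply: xmaxP; rewrite inE.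
apply/seteqP; split=> s; rewrite /line_section/= in_itv/=.
  move=> /Lline Ls; rewrite -(dyB s).
  by apply/andP; split; [apply: xminP|apply: xmaxP]; rewrite inE.
move=> /andP[].
set a := dotv xmin xi; set b := dotv xmax xi => as_ sb.
have [ab|ab] := ltP a b; last first.
  have -> : s = a by apply/eqP; rewrite eq_le as_ andbT; apply: le_trans ab.
  by rewrite -(LK _ Lmin); case: Lmin.
have -> : s *: xi + y *m B = ((b - s) / (b - a)) *: xmin + (1 - (b - s) / (b -
  a)) *: xmax.
  rewrite (LK _ Lmin) (LK _ Lmax) -/a -/b !scalerDr !scalerA addrACA -!scalerDl.
  by rewrite [_ + (1 - _)]addrC subrK scale1r; congr (_ *: _ + _); field; lra.
apply: vK; [by case: Lmin|by case: Lmax|].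
rewrite divr_ge0 ?subr_ge0 ?(ltW ab)//=.
by rewrite ler_pdivrMr ?subr_gt0// mul1r lerB.
Qed.

Lemma shadow_image xi B A : dotv xi xi = 1 -> B *m B^T = 1%:M -> B *m xi^T = 0 ->
  shadow xi B A = (fun x : 'rV[R]_(m.+1) => x *m B^T) @` A.
Proof.
move=> xi1 BB Bxi; have xiB : xi *m B^T = 0.
  by rewrite -[LHS]trmxK trmx_mul trmxK Bxi trmx0.
apply/seteqP; split=> [y [s As]|_ [x Ax <-]].
  by exists (s *: xi + y *m B) => //;
    rewrite mulmxDl -scalemxAl xiB scaler0 add0r -mulmxA BB mulmx1.
have QQ := mulmx1C (frame_orthogonal xi1 BB Bxi).
exists (dotv x xi); rewrite -[X in A X]mulmx1 in Ax; rewrite -QQ in Ax.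
move: Ax; rewrite (@tr_col_mx _ 1 m m.+1 xi B) mulmxA.
rewrite (@mul_mx_row _ 1 m.+1 1 m) (@mul_row_col _ 1 1 m m.+1).
by rewrite [x *m xi^T]mx11_scalar -dotvE mul_scalar_mx.
Qed.

Lemma shadow_compact xi B K : dotv xi xi = 1 -> B *m B^T = 1%:M -> B *m xi^T = 0 ->
  compact K -> compact (shadow xi B K).
Proof.
move=> xi1 BB Bxi cK; rewrite shadow_image//; apply: continuous_compact => //.
apply: continuous_subspaceT; apply: continuous_rV_mulmx.
by move=> u; exact: cvg_id.
Qed.

(* Cavalieri along the lines parallel to xi: the Minkowski sum with [0, t xi]
   lengthens every nonempty chord by t. *)
Lemma volume_mink_sum_seg xi B K t : dotv xi xi = 1 -> B *m B^T = 1%:M ->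
  B *m xi^T = 0 -> compact K -> convex K -> 0 <= t ->
  volume (mink_sum K (seg (t *: xi))) = volume K + t * volume (shadow xi B K).
Proof.
move=> xi1 BB Bxi cK vK t0.
have cS := shadow_compact xi1 BB Bxi cK.
have mS := compact_measurable_rV cS.
have cK' : compact (mink_sum K (seg (t *: xi))) by apply: mink_sum_compact => //;
  exact: seg_compact.
apply: EFin_inj; rewrite EFinD EFinM -!bmeas_leb; try exact: compact_bmeas.
have mK := compact_measurable_rV cK; have mK' := compact_measurable_rV cK'.
have msec A : measurable A ->
    measurable_fun setT (fun y => lebesgue_measure (line_section xi B A y)).
  move=> mA; have := measurable_fun_ysection (@lebesgue_measure R)
    (measurable_line_section xi B mA).
  by apply: eq_measurable_fun => y _ /=; congr lebesgue_measure; apply/seteqP;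
    split => s;
    rewrite /ysection/= inE.
rewrite (leb_frame xi1 BB Bxi mK') (leb_frame xi1 BB Bxi mK).
have -> : (t%:E * leb (shadow xi B K) =
    \int[leb]_y (t%:E * (\1_(shadow xi B K) y)%:E))%E.
  by rewrite ge0_integralZl ?integral_indic ?setIT//; exact: measurableT_comp.
rewrite -ge0_integralD//; last 3 first.
- exact: msec.
- by move=> y _; rewrite mule_ge0 ?lee_fin.
- by apply: measurable_funeM; exact: measurableT_comp.
apply: eq_integral => y _; rewrite indicE.
have [|yS] := boolP (y \in shadow xi B K).
  rewrite inE mule1 => yS;
    have [a [b [ab Iab]]] := line_section_itv xi1 Bxi cK vK yS.
  rewrite Iab (_ : line_section _ _ _ _ = `[a, b + t]%classic).
    rewrite !lebesgue_measure_itv/= !lte_fin.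
    case: (ltgtP a b) ab => // [ab|->] _;
      first by rewrite ltr_wpDr// -!EFinB -EFinD addrAC.
    rewrite add0e; case: ifPn; first by rewrite -EFinB addrAC subrr add0r.
    by rewrite -leNgt gerDl => t0'; congr EFin; apply/eqP; rewrite eq_le t0 t0'.
  apply/seteqP; split=> s; rewrite /line_section/= ?in_itv/=.
    move=> [x Kx [_ [u + <-] xs]]; rewrite /= in_itv/= => /andP[u0 u1];
      rewrite scalerA in xs.
    have : line_section xi B K y (s - u * t).
      by rewrite /line_section/= scalerBl addrAC -xs addrK.
    by rewrite Iab/= in_itv/= => /andP[? ?]; apply/andP; split; nra.
  move=> /andP[as_ sbt]; have [sb|bs] := leP s b.
    exists (s *: xi + y *m B); last by exists 0; [exact: seg0|rewrite addr0].
    by have : line_section xi B K y s by rewrite Iab/= in_itv/= as_.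
  have t0' : 0 < t by lra.
  exists (b *: xi + y *m B).
    by have : line_section xi B K y b by rewrite Iab/= in_itv/= ab lexx.
  exists ((s - b) *: xi); last by rewrite addrAC -scalerDl [b + _]addrC subrK.
  exists ((s - b) / t); last by rewrite scalerA divfK// gt_eqF.
  rewrite /= in_itv/= divr_ge0 ?subr_ge0 ?(ltW bs)//=.
  by rewrite ler_pdivrMr// mul1r lerBlDl.
rewrite mule0 adde0 (_ : line_section _ _ (mink_sum _ _) y = set0).
  rewrite (_ : line_section _ _ K y = set0)//.
  apply/seteqP; split => // s Ks; move: yS; rewrite notin_setE; apply; by exists s.
apply/seteqP; split => // s [x Kx [_ [u _ <-] xs]]; move: yS; rewrite notin_setE;
  apply.
by exists (s - u * t); rewrite scalerBl addrAC -xs scalerA addrK.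
Qed.

End cavalieri.

(** * The Brunn-Minkowski inequality *)

Section one_dimensional.
Context {R : realType}.
Local Notation T := (measurableTypeR R).
Local Notation lam := (@lebesgue_measure R).

(** The graph of x^(m+1) lies above its tangent at [t]. The induction multiplies by [x] and adds
    (m+1) t^m (x - t)^2. At [t = 1] this is Bernoulli's inequality. *)
Lemma exprS_tangent (x t : R) m : 0 <= x -> 0 <= t ->
  m.+1%:R * x * t ^+ m <= x ^+ m.+1 + m%:R * t ^+ m.+1.
Proof.
move=> x0 t0; elim: m => [|m IH];
  first by rewrite expr0 expr1 mul0r addr0 mul1r mulr1.
have tm : 0 <= t ^+ m by rewrite exprn_ge0.
have /(ler_wpM2l x0) {}IH := IH.
have sq : 0 <= m.+1%:R * t ^+ m * (x - t) ^+ 2 by rewrite mulr_ge0 ?sqr_ge0//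
  mulr_ge0.
move: IH sq; rewrite mulrDr -exprS !exprS -[m.+2%:R]natr1 -[m.+1%:R]natr1.
by move: (x ^+ m) (t ^+ m) (m%:R) => X Y M; nra.
Qed.

(* Convexity of x ^ (m+1) / X ^ m, by its tangent of slope (p + q) / (P + Q). *)
Lemma perspective_power (p q P Q : R) m : 0 <= p -> 0 <= q -> 0 < P -> 0 < Q ->
  (p + q) ^+ m.+1 <= (P + Q) ^+ m * (p ^+ m.+1 / P ^+ m + q ^+ m.+1 / Q ^+ m).
Proof.
move=> p0 q0 P0 Q0; have PQ : 0 < P + Q by rewrite addr_gt0.
pose t := (p + q) / (P + Q).
have t0 : 0 <= t by rewrite divr_ge0 ?addr_ge0// ltW.
have tPQ : t * (P + Q) = p + q by rewrite divfK ?gt_eqF.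
have aux x X : 0 <= x -> 0 < X ->
    m.+1%:R * x * t ^+ m - m%:R * X * t ^+ m.+1 <= x ^+ m.+1 / X ^+ m.
  move=> x0 X0; have /(ler_wpM2l (ltW X0)) :=
    exprS_tangent m (divr_ge0 x0 (ltW X0)) t0.
  have Xn0 : X != 0 by rewrite gt_eqF.
  have -> : X * (m.+1%:R * (x / X) * t ^+ m) = m.+1%:R * x * t ^+ m by field.
  have -> : X * ((x / X) ^+ m.+1 + m%:R * t ^+ m.+1) =
      x ^+ m.+1 / X ^+ m + m%:R * X * t ^+ m.+1.
    rewrite expr_div_n [X ^+ m.+1]exprS; have := expf_neq0 m Xn0.
    by move: (X ^+ m) (x ^+ m.+1) (t ^+ m.+1) => Y z w Y0; field; rewrite Xn0 Y0.
  by rewrite lerBlDr.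
apply: (@le_trans _ _ ((P + Q) ^+ m * ((m.+1%:R * p * t ^+ m - m%:R * P * t ^+
  m.+1) +
    (m.+1%:R * q * t ^+ m - m%:R * Q * t ^+ m.+1)))); last first.
  by apply: ler_wpM2l; [rewrite exprn_ge0 ?ltW|apply: lerD; exact: aux].
rewrite le_eqVlt; apply/orP; left; apply/eqP.
transitivity ((P + Q) ^+ m * ((P + Q) * t ^+ m.+1)).
  by rewrite mulrA -exprSr -exprMn mulrC tPQ.
congr (_ * _); rewrite exprS -natr1.
have -> : (m%:R + 1) * p * t ^+ m - m%:R * P * (t * t ^+ m) +
  ((m%:R + 1) * q * t ^+ m - m%:R * Q * (t * t ^+ m)) =
  ((m%:R + 1) * (p + q) - m%:R * (t * (P + Q))) * t ^+ m by ring.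
by rewrite -tPQ; ring.
Qed.

(* With i0 close to sup I and j0 close to inf J, the part of I + j0 below
   i0 + j0 and the part of i0 + J above it are disjoint in C and almost full. *)
Lemma brunn_minkowski1 (I J C : set T) r : measurable I -> measurable J ->
  measurable C ->
  I !=set0 -> J !=set0 -> (forall x, I x -> `|x| <= r) -> (forall x, J x ->
    `|x| <= r) ->
  (forall x y, I x -> J y -> C (x + y)) -> (lam I + lam J <= lam C)%E.
Proof.
move=> mI mJ mC I0 J0 Ir Jr IJC; apply/lee_addgt0Pr => e e0.
have e20 : 0 < e / 2 by rewrite divr_gt0.
have supI : has_sup I by split => //; exists r => x /Ir;
  rewrite ler_norml => /andP[].
have infJ : has_inf J.
  by split => //; exists (- r) => x /Jr; rewrite ler_norml => /andP[].
have [i0 Ii0 i0s] := sup_adherent e20 supI.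
have [j0 Jj0 j0i] := inf_adherent e20 infJ.
have mshift c (A : set T) : measurable A ->
  measurable ((fun x : T => x + c : T) @^-1` A).
  move=> mA; rewrite -[X in measurable X]setTI.
  have : measurable_fun setT (fun x : T => x + c : T) by exact: measurable_funD.
  by apply.
pose I1 := (fun x : T => x + - j0 : T) @^-1` I.
pose J1 := (fun x : T => x + - i0 : T) @^-1` J.
have mI1 : measurable I1 by exact: mshift.
have mJ1 : measurable J1 by exact: mshift.
pose I2 := I1 `&` [set` `]-oo, i0 + j0[].
pose J2 := J1 `&` [set` `[i0 + j0, +oo[].
have mI2 : measurable I2 by apply: measurableI.
have mJ2 : measurable J2 by apply: measurableI.
have lI : (lam I <= lam I2 + (e / 2)%:E)%E.
  rewrite -(lebesgue_measure_shift (- j0) mI) /pushforward -/I1.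
  pose G : set T := [set` `[i0 + j0, i0 + j0 + e / 2]].
  have mG : measurable G by exact: measurable_itv.
  apply: (@le_trans _ _ (lam (I2 `|` G))).
    apply: le_measure; rewrite ?inE//; first exact: measurableU.
    move=> x I1x; have [xs|xs] := ltP x (i0 + j0); first by left; split => //=;
      rewrite in_itv.
    right; rewrite /G/= in_itv/= xs/=.
    have : x - j0 <= sup I by apply: sup_ubound => //; case: supI.
    by move: i0s; lra.
  apply: (le_trans (measureU2 _ mI2 mG)).
  apply: leeD2l; rewrite [leLHS]lebesgue_measure_itv/= lte_fin ltrDl e20.
  by rewrite -EFinB addrAC subrr add0r.
have lJ : (lam J <= lam J2 + (e / 2)%:E)%E.
  rewrite -(lebesgue_measure_shift (- i0) mJ) /pushforward -/J1.
  pose G : set T := [set` `[i0 + j0 - e / 2, i0 + j0]].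
  have mG : measurable G by exact: measurable_itv.
  apply: (@le_trans _ _ (lam (J2 `|` G))).
    apply: le_measure; rewrite ?inE//; first exact: measurableU.
    move=> x J1x; have [xs|xs] := leP (i0 + j0) x; first by left; split => //=;
      rewrite in_itv/= xs.
    right; rewrite /G/= in_itv/= (ltW xs) andbT.
    have : inf J <= x - i0 by apply: inf_lbound => //; case: infJ.
    by move: j0i; lra.
  apply: (le_trans (measureU2 _ mJ2 mG)).
  apply: leeD2l; rewrite [leLHS]lebesgue_measure_itv/= lte_fin ltrBlDr ltrDl e20.
  by rewrite -EFinB opprB addrCA subrr addr0.
have IJ : (lam I2 + lam J2 <= lam C)%E.
  rewrite -measureU//; last first.
    apply/seteqP; split => // x [[_ xl] [_ xr]]; move: xl xr => /=.
    by rewrite !in_itv/= andbT => xl; rewrite leNgt xl.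
  apply: le_measure; rewrite ?inE//; first exact: measurableU.
  move=> x [[I1x _]|[J1x _]]; first by rewrite -(subrK j0 x); apply: IJC.
  by rewrite -(subrK i0 x) addrC; apply: IJC.
apply: (@le_trans _ _ (lam I2 + (e / 2)%:E + (lam J2 + (e / 2)%:E))%E).
  exact: leeD.
by rewrite addeACA -EFinD -splitr leeD2r.
Qed.

(** Both sides are the area of the region of pairs (s, t) with 0 < t < 1 and t al <= a(s),
    integrated in the two orders. *)
Lemma layer_cake (a : T -> R) al : measurable_fun setT a -> (forall s, 0 <= a s) ->
  0 < al ->
  (\int[lam]_s (Num.min (a s / al) 1)%:E =
   \int[lam]_(t in `]0%R, 1%R[) lam [set s | (t * al <= a s)%R])%E.
Proof.
move=> ma a0 al0.
pose S : set (T * T) := [set p | p.2 * al <= a p.1] `&` [set p | `]0, 1[%classic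
  p.2].
have mS : measurable S.
  apply: measurableI.
    rewrite (_ : mkset _ = (fun p : T * T => a p.1 - p.2 * al) @^-1` `[0,
      +oo[%classic).
      rewrite -[X in measurable X]setTI.
      have : measurable_fun setT (fun p : T * T => a p.1 - p.2 * al).
        apply: measurable_funB; first exact: measurableT_comp.
        by apply: measurable_funM.
      by apply.
    by apply/seteqP; split => p /=; rewrite in_itv/= andbT subr_ge0.
  rewrite -[X in measurable X]setTI.
  have : measurable_fun setT (snd : T * T -> T) by [].
  by apply.
have pE : (lam \x lam)%E S = (lam \x^ lam)%E S.
  apply: product_measure_unique => // D D' mD mD'.
  exact: product_measure2E.
transitivity ((lam \x lam)%E S).
  apply: eq_integral => s _ /=.
  have as0 : 0 <= a s / al by rewrite divr_ge0// ltW.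
  have [as1|as1] := ltP (a s / al) 1.
    rewrite (_ : xsection S s = `]0, a s / al]%classic).
      rewrite [RHS]lebesgue_measure_itv/= lte_fin.
      case: ifPn; first by rewrite sube0.
      by rewrite -leNgt => as0'; congr EFin; apply/eqP; rewrite eq_le as0 as0'.
    apply/seteqP; split => t; rewrite /xsection/= inE /S /= !in_itv/= ler_pdivlMr//.
      by move=> [-> /andP[-> _]].
    move=> /andP[t0 tas]; split=> //; rewrite t0/=; apply: le_lt_trans as1.
    by rewrite ler_pdivlMr.
  rewrite (_ : xsection S s = `]0, 1[%classic).
    by rewrite [RHS]lebesgue_measure_itv/= lte_fin ltr01 sube0.
  apply/seteqP; split => t; rewrite /xsection/= inE /S /= !in_itv/=; first by case.
  move=> /andP[t0 t1]; split; last by rewrite t0.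
  by rewrite -ler_pdivlMr//; apply: le_trans as1; exact: ltW.
rewrite pE /product_measure2 [RHS]integral_mkcond; apply: eq_integral => t _ /=.
rewrite patchE; case: ifPn => [|tn].
  rewrite inE/= => t01; congr lam; apply/seteqP; split => s;
    rewrite /ysection/= inE /S /=.
    by case.
  by move=> ?; split.
rewrite (_ : ysection _ _ = set0) ?measure0//.
apply/seteqP; split => // s; rewrite /ysection/= inE /S /= => -[_ t01].
by move: tn; rewrite notin_setE; apply.
Qed.

Lemma measurable_superlevel (a : T -> R) (c : R) : measurable_fun setT a ->
  measurable [set s | c <= a s].
Proof.
move=> ma; rewrite (_ : mkset _ = a @^-1` `[c, +oo[%classic).
  by rewrite -[X in measurable X]setTI; apply: ma.
by apply/seteqP; split => p /=; rewrite in_itv/= andbT.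
Qed.

End one_dimensional.

Section brunn_minkowski.
Context {R : realType}.
Local Notation T := (measurableTypeR R).
Local Notation lam := (@lebesgue_measure R).

Lemma measurable_level_length (a : T -> R) (al : R) : measurable_fun setT a ->
  measurable_fun setT (fun t : T => lam [set s | t * al <= a s]).
Proof.
move=> ma.
have mS : measurable [set p : T * T | p.2 * al <= a p.1].
  rewrite (_ : mkset _ = (fun p : T * T => a p.1 - p.2 * al) @^-1` `[0,
    +oo[%classic).
    rewrite -[X in measurable X]setTI.
    have : measurable_fun setT (fun p : T * T => a p.1 - p.2 * al).
      apply: measurable_funB; first exact: measurableT_comp.
      by apply: measurable_funM.
    by apply.
  by apply/seteqP; split => p /=; rewrite in_itv/= andbT subr_ge0.
have := measurable_fun_ysection lam mS; apply: eq_measurable_fun => t _ /=.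
by congr lam; apply/seteqP; split => s; rewrite /ysection/= inE.
Qed.

Definition slice m (K : set 'rV[R]_(m.+1)) (s : R) : set 'rV[R]_m :=
  [set y | K (row_mx s%:M y)].

Lemma slice_xsection m (K : set 'rV[R]_(m.+1)) s :
  slice K s = xsection (cons_pre K) (s : T).
Proof. by apply/seteqP; split => y; rewrite /xsection/= inE. Qed.

Lemma slice_compact m (K : set 'rV[R]_(m.+1)) s : compact K -> compact (slice K s).
Proof.
move=> cK; apply: bounded_closed_compact.
  have [_ [r Kr]] := compact_bmeas cK.
  exists `|r|; split; first exact: num_real.
  move=> M rM y Ky; apply: normr_rV_le; first by rewrite (le_trans _ (ltW rM)).
  move=> i; have := Kr _ Ky (lift ord0 i); rewrite row_mx_lift => /le_trans; apply.
  by rewrite (le_trans (ler_norm r))// ltW.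
rewrite (_ : slice K s = (fun y => row_mx s%:M y : 'rV[R]_(m.+1)) @^-1` K)//.
apply: preimage_closed; last by apply: compact_closed => //; exact: norm_hausdorff.
move=> x _; apply: continuous_rV => i; case: (unliftP ord0 i) => [j ->|->].
  under eq_fun do rewrite row_mx_lift.
  exact: coord_continuous.
under eq_fun do rewrite row_mx_ord0.
exact: cst_continuous.
Qed.

Lemma leb_slice m (K : set 'rV[R]_(m.+1)) : compact K ->
  leb K = (\int[lam]_s (volume (slice K s))%:E)%E.
Proof.
move=> cK; rewrite leb_cons; apply: eq_integral => s _ /=.
rewrite -bmeas_leb; last exact/compact_bmeas/slice_compact.
by rewrite slice_xsection.
Qed.

Lemma measurable_volume_slice m (K : set 'rV[R]_(m.+1)) : compact K ->
  measurable_fun setT (fun s : T => volume (slice K s)).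
Proof.
move=> cK; apply/measurable_EFinP.
have := measurable_fun_xsection leb (measurable_cons_pre (compact_measurable_rV
  cK)).
apply: eq_measurable_fun => s _ /=.
by rewrite -slice_xsection bmeas_leb//; exact/compact_bmeas/slice_compact.
Qed.

Lemma volume_gt0_nonempty n (A : set 'rV[R]_n) : 0 < volume A -> A !=set0.
Proof. by move=> A0; apply/set0P; apply: contraTneq A0 => ->;
  rewrite volume0 ltxx. Qed.

(** No slice exceeds [al], so the truncation in [layer_cake] is inactive and the slice volumes
    integrate to the volume of [K]. *)
Lemma level_length_slice m (K : set 'rV[R]_(m.+1)) al : compact K -> 0 < al ->
  (forall s, volume (slice K s) <= al) ->
  (\int[lam]_(t in `]0%R, 1%R[) lam [set s | (t * al <= volume (slice K s))%R])%E =
  (volume K / al)%:E.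
Proof.
move=> cK al0 Kal; rewrite -layer_cake//; last 2 first.
- exact: measurable_volume_slice.
- by move=> s; exact: volume_ge0.
rewrite mulrC EFinM -bmeas_leb; last exact: compact_bmeas.
rewrite leb_slice// -ge0_integralZl//; last 3 first.
- by apply/measurable_EFinP; exact: measurable_volume_slice.
- by move=> s _; rewrite lee_fin volume_ge0.
- by rewrite lee_fin invr_ge0 ltW.
apply: eq_integral => s _; rewrite -EFinM [al^-1 * _]mulrC; congr EFin;
  apply/min_idPl.
by rewrite ler_pdivrMr// mul1r.
Qed.

(** Without a bound on the slices, truncation can only lose volume. This is the form for the sum of
    two bodies, whose slices may exceed (P + Q)^m. *)
Lemma level_length_slice_le m (K : set 'rV[R]_(m.+1)) al : compact K -> 0 < al ->
  (\int[lam]_(t in `]0%R, 1%R[) lam [set s | (t * al <= volume (slice K s))%R] <=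
  (volume K / al)%:E)%E.
Proof.
move=> cK al0; have mK := measurable_volume_slice cK.
rewrite -layer_cake//; last by move=> s; exact: volume_ge0.
rewrite mulrC EFinM -bmeas_leb; last exact: compact_bmeas.
rewrite leb_slice// -ge0_integralZl//; last 3 first.
- exact/measurable_EFinP.
- by move=> s _; rewrite lee_fin volume_ge0.
- by rewrite lee_fin invr_ge0 ltW.
apply: ge0_le_integral => //.
- move=> s _; rewrite lee_fin le_min ler01 andbT divr_ge0 ?volume_ge0//; exact: ltW.
- apply/measurable_EFinP; apply: measurable_minr => //.
  by apply: measurable_funM.
- by apply/measurable_EFinP; apply: measurable_funM.
- by move=> s _; rewrite -EFinM lee_fin ge_min mulrC lexx.
Qed.

(** Slice volumes are compared at equal heights t relative to their suprema. At each t < 1 both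
    superlevel sets are then nonempty, as the one-dimensional inequality requires, and their sum
    lies in the superlevel set of K + L; integrating the lengths over t gives the claim. *)
Lemma brunn_minkowski_step m (K L : set 'rV[R]_(m.+1)) (P Q : R) :
  compact K -> compact L -> 0 < P -> 0 < Q ->
  (forall s, volume (slice K s) <= P ^+ m) ->
    (forall s, volume (slice L s) <= Q ^+ m) ->
  (forall t : R, 0 < t < 1 -> exists s, t * P ^+ m <= volume (slice K s)) ->
  (forall t : R, 0 < t < 1 -> exists s, t * Q ^+ m <= volume (slice L s)) ->
  (forall t s r : R, 0 < t < 1 -> t * P ^+ m <= volume (slice K s) ->
    t * Q ^+ m <= volume (slice L r) ->
    t * (P + Q) ^+ m <= volume (slice (mink_sum K L) (s + r))) ->
  (P + Q) ^+ m * (volume K / P ^+ m + volume L / Q ^+ m) <= volume (mink_sum K L).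
Proof.
move=> cK cL P0 Q0 KP LQ Ks Ls KLs.
have cKL := mink_sum_compact cK cL.
have Pm : 0 < P ^+ m by rewrite exprn_gt0.
have Qm : 0 < Q ^+ m by rewrite exprn_gt0.
have PQm : 0 < (P + Q) ^+ m by rewrite exprn_gt0// addr_gt0.
rewrite mulrC -ler_pdivlMr// -lee_fin.
apply: le_trans (level_length_slice_le cKL PQm).
have mK := measurable_volume_slice cK; have mL := measurable_volume_slice cL.
have mKL := measurable_volume_slice cKL.
have mlev (a : T -> R) (al : R) : measurable_fun setT a ->
    measurable_fun (`]0, 1[%classic : set T) (fun t : T => lam [set s | t * al <=
      a s]).
  by move=> ma; apply: measurable_funTS; exact: measurable_level_length.
rewrite EFinD -(level_length_slice cK Pm KP) -(level_length_slice cL Qm LQ).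
rewrite -ge0_integralD//; [|exact: mlev|exact: mlev].
apply: ge0_le_integral => //.
- by move=> t _; rewrite adde_ge0.
- by apply: emeasurable_funD; exact: mlev.
- exact: mlev.
move=> t; rewrite /= in_itv/= => t01; have /andP[t0 t1] := t01.
have [_ [r Kr]] := compact_bmeas cK; have [_ [r' Lr]] := compact_bmeas cL.
have bnd (A : set 'rV[R]_(m.+1)) rho X s : A `<=` cube rho -> 0 < X ->
    t * X <= volume (slice A s) -> `|s| <= rho.
  move=> Arho X0 tX; have [y Ay] : slice A s !=set0.
    by apply: volume_gt0_nonempty; apply: lt_le_trans tX; rewrite mulr_gt0.
  by have := Arho _ Ay ord0; rewrite row_mx_ord0.
apply: (@brunn_minkowski1 _ _ _ _ (Num.max r r')).
- exact: measurable_superlevel.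
- exact: measurable_superlevel.
- exact: measurable_superlevel.
- by have [s ?] := Ks t t01; exists s.
- by have [s ?] := Ls t t01; exists s.
- by move=> s /= /(bnd _ _ _ _ Kr Pm); rewrite le_max => ->.
- by move=> s /= /(bnd _ _ _ _ Lr Qm); rewrite le_max orbC => ->.
- by move=> s s' /= Hs Hs'; exact: KLs.
Qed.

Lemma volume_rV0 (A : set 'rV[R]_0) : A !=set0 -> volume A = 1.
Proof.
move=> [x Ax]; have -> : A = @cube R 0 1.
  by apply/seteqP; split => y _; [case|rewrite (thinmx0 y) -(thinmx0 x)].
by rewrite /volume -/(leb _) leb_cube.
Qed.

Lemma exists_nth_root (x : R) m : (0 < m)%N -> 0 <= x ->
  exists2 y, 0 <= y & y ^+ m = x.
Proof.
move=> m0 x0; exists (x `^ m%:R^-1); first exact: powR_ge0.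
by rewrite -powR_mulrn ?powR_ge0// -powRrM mulVf ?powRr1// pnatr_eq0 -lt0n.
Qed.

Lemma slice_mink_sum m (K L : set 'rV[R]_(m.+1)) s r :
  mink_sum (slice K s) (slice L r) `<=` slice (mink_sum K L) (s + r).
Proof.
move=> _ [x Kx [y Ly <-]]; exists (row_mx s%:M x) => //;
  exists (row_mx r%:M y) => //.
by rewrite row_mxD1.
Qed.

(** Induction on the dimension: the inequality for slices feeds [brunn_minkowski_step], and
    [perspective_power] turns its conclusion into a power of p + q. Using lower bounds [p], [q] in
    place of the roots of the volumes keeps fractional powers out of the statement and lets
    dimension 0 be the base case. *)
Theorem brunn_minkowski n (K L : set 'rV[R]_n) (p q : R) :
  compact K -> compact L -> K !=set0 -> L !=set0 -> 0 <= p -> 0 <= q ->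
  p ^+ n <= volume K -> q ^+ n <= volume L -> (p + q) ^+ n <= volume (mink_sum K L).
Proof.
elim: n K L p q => [|m IH] K L p q cK cL K0 L0 p0 q0 pK qL.
  move: K0 L0 => [x Kx] [y Ly]; rewrite expr0 volume_rV0//.
  by exists (x + y); exists x => //; exists y.
have cKL := mink_sum_compact cK cL.
have [->|pn0] := eqVneq p 0.
  have [x Kx] := K0; rewrite add0r; apply: le_trans qL _.
  rewrite -(volume_shift x (compact_measurable_rV cL)); apply: le_volume.
  - by apply: compact_measurable_rV; apply: mink_sum_compact => //;
    exact: compact_set1.
  - exact: compact_bmeas.
  - by rewrite mink_sumC; apply: mink_sumS => // _ ->.
have [->|qn0] := eqVneq q 0.
  have [x Lx] := L0; rewrite addr0; apply: le_trans pK _.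
  rewrite -(volume_shift x (compact_measurable_rV cK)); apply: le_volume.
  - by apply: compact_measurable_rV; apply: mink_sum_compact => //;
    exact: compact_set1.
  - exact: compact_bmeas.
  - by apply: mink_sumS => // _ ->.
have {p0}p0 : 0 < p by rewrite lt_neqAle eq_sym pn0.
have {q0}q0 : 0 < q by rewrite lt_neqAle eq_sym qn0.
(* P ^ m is the supremum of the volumes of the slices. *)
have slice_sup (A : set 'rV[R]_(m.+1)) (c : R) : compact A -> A !=set0 -> 0 < c ->
    c ^+ m.+1 <= volume A -> exists P, [/\ 0 < P,
      forall s, volume (slice A s) <= P ^+ m &
      forall t : R, 0 < t < 1 -> exists s, t * P ^+ m <= volume (slice A s)].
  move=> cA [x Ax] c0 cA'.
  case: m {IH K L cK cL K0 L0 pK qL cKL} A x cA Ax cA' => [|m] A x cA Ax cA'.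
    (* Slices in dimension 0 have volume 0 or 1, and P^0 = 1 for every P, so no root is to be
       extracted. *)
    exists 1; split => // [s|t /andP[t0 t1]].
      rewrite expr0; have [->|/set0P s0] := eqVneq (slice A s) set0.
        by rewrite volume0.
      by rewrite volume_rV0.
    have [s [y xE]] := row_mxP1 x; exists s; rewrite expr0 mulr1 volume_rV0 ?ltW//.
    by exists y; rewrite /slice/= -xE.
  have [_ [r Ar]] := compact_bmeas cA.
  pose V := range (fun s => volume (slice A s)).
  have r0 : 0 <= r by apply: le_trans (Ar _ Ax ord0).
  have supV : has_sup V.
    split; first by exists (volume (slice A 0)), 0.
    exists (volume (@cube R m.+1 r)) => _ [s _ <-]; apply: le_volume.
    - by apply: compact_measurable_rV; exact: slice_compact.
    - by split; [exact: measurable_cube|exists r].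
    - by move=> y Ay i; have := Ar _ Ay (lift ord0 i); rewrite row_mx_lift.
  have ubV s : volume (slice A s) <= sup V by apply: sup_ubound;
    [case: supV|exists s].
  have supV0 : 0 < sup V.
    rewrite ltNge; apply/negP => V0.
    have : (leb A <= 0)%E.
      rewrite leb_slice// [leLHS]integral0_eq// => s _; congr EFin; apply/eqP.
      by rewrite eq_le volume_ge0 andbT; apply: le_trans (ubV s) V0.
    rewrite bmeas_leb; last exact: compact_bmeas.
    rewrite lee_fin.
    by apply/negP; rewrite -ltNge; apply: lt_le_trans cA'; rewrite exprn_gt0.
  have [P P0 PE] := exists_nth_root (ltn0Sn m) (ltW supV0).
  have Pgt0 : 0 < P.
    by rewrite lt_neqAle P0 andbT; apply: contraTneq supV0 => P00;
      rewrite -PE -P00 expr0n ltxx.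
  exists P; rewrite PE; split => // t /andP[t0 t1].
  have : 0 < (1 - t) * sup V by rewrite mulr_gt0// subr_gt0.
  move=> /sup_adherent /(_ supV)[_ [s _ <-] Hs]; exists s; apply: ltW.
  by apply: le_lt_trans Hs; rewrite mulrBl mul1r opprB addrCA subrr addr0.
have [P [P0 KP KPs]] := slice_sup K p cK K0 p0 pK.
have [Q [Q0 LQ LQs]] := slice_sup L q cL L0 q0 qL.
apply: le_trans (brunn_minkowski_step cK cL P0 Q0 KP LQ KPs LQs _).
  apply: le_trans (perspective_power m (ltW p0) (ltW q0) P0 Q0) _.
  apply: ler_wpM2l; first by rewrite exprn_ge0// addr_ge0 ?ltW.
  by apply: lerD; rewrite ler_pM2r// invr_gt0 exprn_gt0.
move=> t s r /andP[t0 t1] tK tL.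
have sK : slice K s !=set0.
  by apply: volume_gt0_nonempty; apply: lt_le_trans tK; rewrite mulr_gt0 ?exprn_gt0.
have sL : slice L r !=set0.
  by apply: volume_gt0_nonempty; apply: lt_le_trans tL; rewrite mulr_gt0 ?exprn_gt0.
have ccK : compact (slice K s) by exact: slice_compact.
have ccL : compact (slice L r) by exact: slice_compact.
apply: (@le_trans _ _ (volume (mink_sum (slice K s) (slice L r)))); last first.
  apply: le_volume; last exact: slice_mink_sum.
  - by apply: compact_measurable_rV; exact: mink_sum_compact.
  - exact/compact_bmeas/slice_compact.
case: m IH K L s r sK sL ccK ccL tK tL {pK qL cK cL K0 L0 cKL slice_sup KP KPs LQ
  LQs}
  => [|m] IH K L s r [x Kx] [y Ly] ccK ccL tK tL.
  rewrite expr0 mulr1 volume_rV0 ?ltW//.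
  by exists (x + y); exists x => //; exists y.
(* Writing t = u^(m+1) turns t P^(m+1) into (u P)^(m+1), the shape that the induction hypothesis
   accepts. *)
have [u u0 uE] := exists_nth_root (ltn0Sn m) (ltW t0).
rewrite -uE -exprMn mulrDr; apply: IH => //.
- by exists x.
- by exists y.
- by rewrite mulr_ge0// ltW.
- by rewrite mulr_ge0// ltW.
- by rewrite exprMn uE.
- by rewrite exprMn uE.
Qed.

End brunn_minkowski.

(** * Separation and approximation by polytopes *)

Section separation.
Context {R : realType} {n : nat}.
Implicit Types (A M : set 'rV[R]_n) (x y z u : 'rV[R]_n).

(** Stands in for the limit t -> 0 in all the first-order comparisons below. *)
Lemma le_of_small_perturbation (x y D t0 : R) : 0 < t0 ->
  (forall t, 0 < t <= t0 -> x <= y + t * D) -> x <= y.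
Proof.
move=> t00 H; apply/ler_addgt0Pr => e e0.
pose t := Num.min t0 (e / (`|D| + 1)).
have D1 : 0 < `|D| + 1 by rewrite ltr_pwDr.
have t0' : 0 < t by rewrite lt_min t00 divr_gt0.
apply: le_trans (H t _) _; first by rewrite t0' ge_min lexx.
rewrite lerD2l; apply: (@le_trans _ _ (t * (`|D| + 1))).
  by rewrite ler_pM2l// (le_trans (ler_norm D))// lerDl.
by rewrite -ler_pdivlMr// ge_min lexx orbT.
Qed.

Lemma continuous_id_dotv u : continuous (fun x => dotv u x).
Proof.
apply: continuous_dotv; first exact: cst_continuous.
by move=> x; exact: cvg_id.
Qed.

(** The normal is [y - x0], with [x0] the point of [A] nearest to [y]: moving from [x0] towards [x]
    cannot decrease the distance to [y], and the first-order term of this gives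
    [dotv u (x - x0) <= 0]. *)
Lemma separation A y : compact A -> convex A -> ~ A y ->
  exists u, forall x, A x -> dotv u x < dotv u y.
Proof.
move=> cA vA Ay; have [->|/set0P A0] := eqVneq A set0; first by exists 0.
have cd : {within A, continuous (fun x => dotv (x + - y) (x + - y))}.
  apply: continuous_subspaceT; apply: continuous_dotv; apply: continuous_rVD;
  by [move=> x; exact: cvg_id|exact: cst_continuous].
have [x0 + x0P] := EVT_min_rV A0 cA cd; rewrite inE => Ax0.
pose u := y - x0; exists u => x Ax.
have u0 : u != 0 by rewrite subr_eq0; apply: contra_notN Ay => /eqP ->.
have uu := dotvv_gt0 u0.
suff : dotv u (x - x0) <= 0.
  by move: uu; rewrite {2}/u !dotvDr !dotvNr; lra.
apply: (@le_of_small_perturbation _ _ (dotv (x - x0) (x - x0)) 1) => // t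
  /andP[t0 t1].
rewrite add0r.
have /x0P : t *: x + (1 - t) *: x0 \in A by rewrite inE; apply: vA => //;
  rewrite (ltW t0).
rewrite (_ : t *: x + (1 - t) *: x0 - y = t *: (x - x0) - u); last first.
  by rewrite /u scalerBl scale1r scalerBr opprB; apply/rowP => i; rewrite !mxE;
    ring.
rewrite (_ : x0 - y = - u); last by rewrite opprB.
set w := x - x0; clearbody u w.
rewrite !(dotvDl, dotvDr, dotvNl, dotvNr, dotvZl, dotvZr, opprK) (dotvC w u).
set p := dotv u w; set q := dotv w w => H.
have q0 : 0 <= q by exact: dotvv_ge0.
have : 0 <= t * (t * q - 2 * p) by move: H; lra.
rewrite pmulr_rge0// => H2.
have : 0 <= t * q by rewrite mulr_ge0// ltW.
lra.
Qed.

(** Half-spaces normalised to right-hand side 1 describe bodies with the origin in the interior, and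
    are the data of Cauchy's formula. *)
Definition polytope (D : seq 'rV[R]_n) : set 'rV[R]_n :=
  [set y | forall a, a \in D -> dotv a y <= 1].

Lemma polytope_closed D : closed (polytope D).
Proof.
rewrite (_ : polytope D = \bigcap_(a in [set` D]) (dotv a @^-1` [set r | r <= 1])).
  apply: closed_bigI => a _; apply: preimage_closed; last exact: closed_le.
  by move=> x _; exact: continuous_id_dotv.
by apply/seteqP; split => y Py a; exact: Py.
Qed.

Lemma polytope_convex D : convex (polytope D).
Proof.
move=> x y t Px Py /andP[t0 t1] a aD; rewrite dotvDr !dotvZr.
by have := Px a aD; have := Py a aD; nra.
Qed.

Lemma ball_cube x r : 0 < r -> ball x r `<=` [set y | cube r (y - x)].
Proof.
move=> r0 y; rewrite -ball_normE /= => xy i.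
by apply: le_trans (ltW xy); rewrite distrC; exact: normr_coord_le.
Qed.

Lemma cube0 r : 0 <= r -> @cube R n r 0.
Proof. by move=> r0 i; rewrite mxE normr0. Qed.

(** Each boundary point of the enlarged body is strictly cut off by a half-space containing [M], and
    by compactness of that boundary finitely many half-spaces suffice. A point of the polytope
    outside the enlarged body would force the segment from 0 to it across the boundary. *)
Lemma polytope_approx M rho del : compact M -> convex M -> 0 < rho ->
  cube rho `<=` M ->
  0 < del -> exists D : seq 'rV[R]_n,
    M `<=` polytope D /\ polytope D `<=` dilate (1 + del) M.
Proof.
move=> cM vM rho0 rhoM del0.
have del1 : 0 < 1 + del by rewrite addr_gt0.
pose M' := dilate (1 + del) M.
have cM' : compact M' by exact: dilate_compact.
have vM' : convex M' by exact: dilate_convex.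
have M0 : M 0 by apply: rhoM; apply: cube0; exact: ltW.
(* (1 + del) M = M + del M contains M + del [cube rho], a neighbourhood of [M]. *)
have MintM' : M `<=` M'°.
  move=> x Mx; rewrite /interior; apply/nbhs_ballP; exists (del * rho) => /=.
    by rewrite mulr_gt0.
  have dr0 : 0 < del * rho by rewrite mulr_gt0.
  move=> y /(ball_cube dr0) /= yx; rewrite /M' -(@mink_sum_scale R n)//.
  rewrite dilate1; exists x => //; exists (y - x); last by rewrite addrC subrK.
  exists (del^-1 *: (y - x)); last by rewrite scalerA mulfV ?scale1r// gt_eqF.
  apply: rhoM => i; rewrite mxE normrM gtr0_norm ?invr_gt0// mulrC ler_pdivrMr//.
  by rewrite mulrC; exact: yx.
pose S := M' `&` ~` M'°.
have cS : compact S.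
  by apply: compact_closedI => //; exact/open_closedC/open_interior.
pose E : set 'rV[R]_n := [set a | forall x, M x -> dotv a x <= 1].
pose f (a : 'rV[R]_n) : set 'rV[R]_n := [set z | 1 < dotv a z].
have fO a : E a -> open (f a).
  move=> _; apply: (@open_comp _ _ (dotv a) [set r | 1 < r]); last exact: open_gt.
  by move=> x _; exact: continuous_id_dotv.
have Sf : S `<=` cover E f.
  move=> z [M'z Mz].
  have {}Mz : ~ M z by move=> /MintM'.
  have [u uP] := separation cM vM Mz.
  have [x0 + x0P] := EVT_max_rV (ex_intro _ 0 M0) cM
    (continuous_subspaceT (@continuous_id_dotv u)).
  rewrite inE => Mx0.
  have c0 : 0 <= dotv u x0 by rewrite -(dotv0r u); apply: x0P; rewrite inE.
  have cz := uP _ Mx0.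
  (* The midpoint between the maximum over [M] and the value at [z]: after division by it, [M]
     satisfies the constraint and [z] violates it strictly. *)
  pose k := (dotv u x0 + dotv u z) / 2.
  have k0 : 0 < k by rewrite divr_gt0//; lra.
  exists (k^-1 *: u).
    move=> x Mx; rewrite dotvZl mulrC ler_pdivrMr// mul1r /k.
    have : dotv u x <= dotv u x0 by apply: x0P; rewrite inE.
    lra.
  by rewrite /f/= dotvZl mulrC ltr_pdivlMr// mul1r /k; lra.
move: cS; rewrite compact_cover => /(_ _ E f fO Sf)[D' DE SD].
pose D : seq 'rV[R]_n := finmap.enum_fset D'.
exists D; split; first by move=> x Mx a /DE; rewrite inE => /(_ x Mx).
move=> y Py; apply: contrapT => M'y.
have cA : compact (seg y `&` M').
  by apply: compact_closedI; [exact: seg_compact|apply: compact_closed].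
have M'0 : M' 0 by exists 0 => //; rewrite scaler0.
(* [x0] is the last point of the segment from 0 to [y] that lies in [M'], hence a boundary point,
   and it is still in the polytope. *)
have [x0 + x0P] := EVT_max_rV (ex_intro _ 0 (conj (seg0 y) M'0)) cA
    (continuous_subspaceT (@continuous_id_dotv y)).
rewrite inE => -[[t + tx0] M'x0]; rewrite /= in_itv/= => /andP[t0 t1].
have y0 : y != 0 by apply: contra_notN M'y => /eqP ->.
have yy := dotvv_gt0 y0.
have t1' : t < 1.
  rewrite lt_neqAle t1 andbT; apply: contra_notN M'y => /eqP tE.
  by move: M'x0; rewrite -tx0 tE scale1r.
have Px0 : polytope D x0.
  move=> a aD; rewrite -tx0 dotvZr; have := Py a aD; nra.
have : S x0.
  split=> // /nbhs_ballP[e /= e0 eM'].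
  have ny : 0 < `|y| by rewrite normr_gt0.
  pose s := Num.min (1 - t) (e / (2 * `|y|)).
  have s0 : 0 < s by rewrite lt_min subr_gt0 t1'/= divr_gt0// mulr_gt0.
  have : M' (x0 + s *: y).
    apply: eM'; rewrite -ball_normE /= opprD addrA subrr add0r normrN normrZ
      gtr0_norm//.
    apply: (@le_lt_trans _ _ (e / (2 * `|y|) * `|y|)).
      by rewrite ler_pM2r// ge_min lexx orbT.
    by rewrite invfM mulrA mulfVK ?gt_eqF// ltr_pdivrMr//; lra.
  move=> M'xs; have : dotv y (x0 + s *: y) <= dotv y x0.
    apply: x0P; rewrite inE; split=> //; exists (t + s);
      last by rewrite -tx0 scalerDl.
    rewrite /= in_itv/= addr_ge0//= ?(ltW s0)//.
    by rewrite -lerBrDl ge_min lexx.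
  rewrite dotvDr dotvZr gerDl; apply/negP; rewrite -ltNge.
  by rewrite mulr_gt0.
move=> /SD[a /= aD]; rewrite /f/= => ax0.
by have := Px0 a aD; rewrite leNgt ax0.
Qed.

End separation.

(** * Projection functions *)

Section swept_volume.
Context {R : realType} {m : nat}.
Implicit Types (xi x : 'rV[R]_(m.+1)) (B : 'M[R]_(m, m.+1)) (A K : set
  'rV[R]_(m.+1)).

(* A Householder reflection exchanges xi with the first basis vector; its other
   rows form a frame of the hyperplane. *)
Lemma perp_frame_exists xi : dotv xi xi = 1 -> exists B : 'M[R]_(m, m.+1),
  B *m B^T = 1%:M /\ B *m xi^T = 0.
Proof.
move=> xi1; pose e0 : 'rV[R]_(m.+1) := delta_mx ord0 ord0.
have e01 : dotv e0 e0 = 1 by rewrite dotvE /e0 trmx_delta mul_delta_mx mxE.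
pose v := xi - e0.
pose c := if v == 0 then 0 else 2 / dotv v v.
pose Q : 'M[R]_(m.+1) := 1%:M - c *: (v^T *m v).
have QT : Q^T = Q by rewrite /Q linearB /= linearZ /= trmx1 trmx_mul trmxK.
have vv : v *m v^T = (dotv v v)%:M by rewrite [LHS]mx11_scalar -dotvE.
have cc : c * c * dotv v v = c *+ 2.
  rewrite /c; have [->|v0] := eqVneq v 0; first by rewrite !mul0r mul0rn.
  by have := dotvv_gt0 v0 => /lt0r_neq0 ?; rewrite -mulr_natl; field.
have QQ : Q *m Q^T = 1%:M.
  have AA : (c *: (v^T *m v)) *m (c *: (v^T *m v)) = (c *: (v^T *m v)) *+ 2.
    rewrite -scalemxAl -scalemxAr scalerA -mulmxA (mulmxA v) vv mul_scalar_mx.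
    by rewrite -scalemxAr scalerA cc scalerMnl.
  rewrite QT /Q; move: AA; set A := c *: _ => AA.
  rewrite mulmxBl !mulmxBr !mul1mx !mulmx1 AA mulr2n.
  by apply/matrixP => i j; rewrite !mxE; ring.
have Q0 : e0 *m Q = xi.
  rewrite /Q mulmxBr mulmx1 -scalemxAr mulmxA [e0 *m v^T]mx11_scalar -dotvE.
  rewrite mul_scalar_mx scalerA.
  have [v0|v0] := eqVneq v 0.
    by rewrite /c v0 eqxx mul0r scale0r subr0; move/eqP: v0;
      rewrite subr_eq0 => /eqP.
  have e0v : dotv v v = - (dotv e0 v) *+ 2.
    by rewrite /v !(dotvDl, dotvDr, dotvNl, dotvNr) xi1 e01 (dotvC xi e0); ring.
  have vv0 := lt0r_neq0 (dotvv_gt0 v0).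
  have -> : c * dotv e0 v = -1.
    rewrite /c (negbTE v0); move: e0v vv0; set q := dotv v v; set p := dotv e0 v.
    by move=> -> p0; field; move: p0; rewrite -mulr_natr;
      apply: contra_neq => ->; ring.
  by rewrite scaleN1r opprK /v addrC subrK.
pose B : 'M[R]_(m, m.+1) := @dsubmx R 1 m m.+1 Q.
have QE : Q = col_mx xi B :> 'M[R]_(1 + m, m.+1).
  rewrite -[LHS](@vsubmxK _ 1 m); congr col_mx.
  rewrite -Q0 /e0 -rowE; apply/rowP => j; rewrite [LHS]mxE [RHS]mxE.
  by congr (fun_of_matrix Q _ _); exact/val_inj.
exists B; move: QQ; rewrite QE (@tr_col_mx _ 1 m m.+1 xi B) (@mul_col_row _ 1 m
  m.+1 1 m).
have -> : (1%:M : 'M[R]_(m.+1)) = (1%:M : 'M[R]_(1 + m)) by [].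
by rewrite scalar_mx_block => /(@eq_block_mx _ 1 m 1 m)[_ _ -> ->].
Qed.

Lemma esphereE xi : esphere m.+1 xi <-> dotv xi xi = 1.
Proof.
split=> [xi1|xi1]; last by rewrite /esphere/= /enorm xi1 sqrtr1.
by rewrite -enorm_sqr xi1 expr1n.
Qed.

(* The projection function of K, extended by positive homogeneity: for a unit
   vector xi, [swept K (t *: xi)] is t times the volume of the projection of K
   along xi (see [swept_volume_perp]). *)
Definition swept K x : R := volume (mink_sum K (seg x)) - volume K.

(** A frame exists, so the default value of [xget] never occurs. One frame serves all bodies, which
    makes their projections along [xi] comparable. *)
Lemma volume_perpE xi : esphere m.+1 xi -> exists B,
  [/\ B *m B^T = 1%:M, B *m xi^T = 0 &
    forall K, volume_perp xi (proj_perp xi K) = volume (shadow xi B K)].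
Proof.
move=> /esphereE xi1; have [B0 B0P] := perp_frame_exists xi1.
have : perp_frame xi (xget 0 (perp_frame xi)) := xgetPex 0 (ex_intro _ B0 B0P).
rewrite /volume_perp; set B := xget _ _ => -[BB Bxi]; exists B; split => // K.
congr volume; apply/seteqP; split=> y.
  by move=> [x Kx /= xy]; exists (dotv x xi); rewrite -xy addrC subrK.
move=> [s Ks]; exists (s *: xi + y *m B) => //.
rewrite dotvDl dotvZl xi1 mulr1 (_ : dotv (y *m B) xi = 0) ?addr0; last first.
  by rewrite dotvE -mulmxA Bxi mulmx0 mxE.
by rewrite addrAC subrr add0r.
Qed.

Lemma swept_volume_perp K xi t : compact K -> convex K -> esphere m.+1 xi ->
  0 <= t ->
  swept K (t *: xi) = t * volume_perp xi (proj_perp xi K).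
Proof.
move=> cK vK sxi t0; have [B [BB Bxi ->]] := volume_perpE sxi.
have /esphereE xi1 := sxi.
by rewrite /swept (volume_mink_sum_seg xi1 BB Bxi)// addrC addKr.
Qed.

Lemma enormalize x : x != 0 -> exists xi, esphere m.+1 xi /\ x = enorm x *: xi.
Proof.
move=> x0; have ex := enorm_gt0 x0; exists ((enorm x)^-1 *: x); split.
  by rewrite /esphere/= enormZ gtr0_norm ?invr_gt0// mulVf ?gt_eqF.
by rewrite scalerA mulfV ?scale1r// gt_eqF.
Qed.

Lemma seg00 : seg (0 : 'rV[R]_(m.+1)) = [set 0].
Proof.
apply/seteqP; split=> [_ [t _ <-]|_ ->]; first by rewrite scaler0.
exact: seg0.
Qed.

Lemma swept0 K : swept K 0 = 0.
Proof. by rewrite /swept seg00 mink_sum0 subrr. Qed.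

(** Not visible on a difference of volumes; after Cavalieri it is the inclusion of the shadows. *)
Lemma swept_mono K K' x : compact K -> convex K -> compact K' -> convex K' ->
  K `<=` K' -> swept K x <= swept K' x.
Proof.
move=> cK vK cK' vK' KK'.
have [->|x0] := eqVneq x 0; first by rewrite !swept0.
have [xi [sxi ->]] := enormalize x0.
rewrite !swept_volume_perp ?enorm_ge0//; apply: ler_wpM2l; first exact: enorm_ge0.
have [B [BB Bxi volE]] := volume_perpE sxi; have /esphereE xi1 := sxi.
rewrite !volE; apply: le_volume.
- by apply: compact_measurable_rV; exact: shadow_compact.
- by apply: compact_bmeas; exact: shadow_compact.
- by move=> y [s /KK' ?]; exists s.
Qed.

Lemma sweptZ K x c : compact K -> convex K -> 0 <= c ->
  swept K (c *: x) = c * swept K x.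
Proof.
move=> cK vK c0; have [->|x0] := eqVneq x 0; first by rewrite scaler0 swept0 mulr0.
have [xi [sxi ->]] := enormalize x0.
rewrite scalerA !swept_volume_perp ?enorm_ge0 ?mulr_ge0 ?enorm_ge0//.
by rewrite mulrA.
Qed.

(** c K + [0, x] = c (K + [0, x / c]) contributes c^(m+1), and homogeneity in [x] takes one factor
    back. *)
Lemma swept_dilate K x c : compact K -> convex K -> 0 < c ->
  swept (dilate c K) x = c ^+ m * swept K x.
Proof.
move=> cK vK c0; have c0' : c != 0 by rewrite gt_eqF.
have xE : seg x = dilate c (seg (c^-1 *: x)) by rewrite dilate_seg scalerA
  mulfV// scale1r.
rewrite {1}/swept xE -dilate_mink_sum !volume_dilate//; last 2 first.
- exact: compact_measurable_rV.
- by apply: compact_measurable_rV; apply: mink_sum_compact => //;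
  exact: seg_compact.
by rewrite -mulrBr -/(swept K _) sweptZ ?invr_ge0 ?ltW// mulrA exprSr mulfK.
Qed.

Lemma swept_ge0 K x : compact K -> 0 <= swept K x.
Proof.
move=> cK; rewrite subr_ge0; apply: le_volume.
- exact: compact_measurable_rV.
- by apply: compact_bmeas; apply: mink_sum_compact => //; exact: seg_compact.
- by move=> y Ky; exists y => //; exists 0; [exact: seg0|rewrite addr0].
Qed.

Lemma swept_shift K v x : compact K -> swept (mink_sum K [set v]) x = swept K x.
Proof.
move=> cK; have cKx : compact (mink_sum K (seg x)) by apply: mink_sum_compact =>
  //; exact: seg_compact.
rewrite /swept -mink_sumA (mink_sumC [set v]) mink_sumA.
by rewrite !volume_shift//; exact: compact_measurable_rV.
Qed.

Lemma eball_shadow xi B : dotv xi xi = 1 -> B *m B^T = 1%:M -> B *m xi^T = 0 ->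
  shadow xi B (eball m.+1) = eball m.
Proof.
move=> xi1 BB Bxi.
have nE s y : dotv (s *: xi + y *m B) (s *: xi + y *m B) = s ^+ 2 + dotv y y.
  have yB : dotv (y *m B) xi = 0 by rewrite dotvE -mulmxA Bxi mulmx0 mxE.
  rewrite !(dotvDl, dotvDr, dotvZl, dotvZr) xi1 (dotvC xi) yB.
  rewrite [dotv (y *m B) _]dotvE trmx_mul mulmxA -(mulmxA y) BB mulmx1 -dotvE.
  by ring.
apply/seteqP; split=> y; rewrite eballE /shadow eballE /=.
  by move=> [s]; rewrite nE => /(le_trans _); apply; rewrite lerDr sqr_ge0.
by move=> y1; exists 0; rewrite nE expr0n add0r.
Qed.

Lemma eball_compact : compact (@eball R m.+1).
Proof.
apply: bounded_closed_compact.
  exists 1; split; first exact: num_real.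
  move=> M M1 x x1; apply: normr_rV_le; first by rewrite (le_trans ler01)// ltW.
  move=> i; rewrite (le_trans (coord_le_enorm _ _))// (le_trans x1)//; exact: ltW.
rewrite eballE (_ : mkset _ = (fun x : 'rV[R]_m.+1 => dotv x x) @^-1` [set r | r
  <= 1])//.
apply: preimage_closed; last exact: closed_le.
by move=> x _; apply: continuous_dotv; move=> y; exact: cvg_id.
Qed.

Lemma eball_convex : convex (@eball R m.+1).
Proof.
move=> x y t; rewrite eballE /= => x1 y1 /andP[t0 t1].
have := dotvv_ge0 (x - y).
rewrite !(dotvDl, dotvDr, dotvZl, dotvZr, dotvNl, dotvNr) (dotvC y x).
move: x1 y1; set a := dotv x x; set b := dotv y y; set c := dotv x y => a1 b1 H.
have : 0 <= t * (1 - t) * (a - c - (c - b)).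
  by rewrite !mulr_ge0 ?subr_ge0//; move: H; lra.
nra.
Qed.

Lemma swept_eball xi t : esphere m.+1 xi -> 0 <= t ->
  swept (eball m.+1) (t *: xi) = t * volume (@eball R m).
Proof.
move=> sxi t0; rewrite swept_volume_perp//;
  [|exact: eball_compact|exact: eball_convex].
have [B [BB Bxi ->]] := volume_perpE sxi.
by have /esphereE xi1 := sxi; rewrite eball_shadow.
Qed.

End swept_volume.

(** * Cauchy's projection formula for polytopes *)

Section halfspaces.
Context {R : realType} {m : nat}.
Implicit Types (b x y : 'rV[R]_(m.+1)) (A U N : set 'rV[R]_(m.+1)).

Lemma measurable_dotv_preimage b (S : set R) : measurable S ->
  measurable (dotv b @^-1` S).
Proof.
move=> mS; rewrite -[X in measurable X]setTI.
have : measurable_fun setT (fun y => dotv b y : measurableTypeR R) by exact: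
  measurable_dotv.
by apply.
Qed.

Lemma measurable_dotv_le b (c : R) : measurable [set y | dotv b y <= c].
Proof.
rewrite (_ : mkset _ = dotv b @^-1` `]-oo, c]%classic);
  first exact: measurable_dotv_preimage.
by apply/seteqP; split => y /=; rewrite in_itv.
Qed.

Lemma measurable_dotv_gt b (c : R) : measurable [set y | c < dotv b y].
Proof.
rewrite (_ : mkset _ = dotv b @^-1` `]c, +oo[%classic);
  first exact: measurable_dotv_preimage.
by apply/seteqP; split => y /=; rewrite in_itv/= andbT.
Qed.

Lemma measurable_hyperplane b : measurable [set y | dotv b y = 0].
Proof.
by rewrite (_ : mkset _ = dotv b @^-1` [set 0])//; exact: measurable_dotv_preimage.
Qed.

Lemma leb_hyperplane b : b != 0 -> leb [set y | dotv b y = 0] = 0%E.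
Proof.
move=> b0; have [xi [sxi bE]] := enormalize b0; have bgt0 := enorm_gt0 b0.
have /esphereE xi1 := sxi; have [B [BB Bxi]] := perp_frame_exists xi1.
rewrite (leb_frame xi1 BB Bxi); last exact: measurable_hyperplane.
apply: integral0_eq => y _.
rewrite (_ : line_section _ _ _ _ = [set 0]); first exact: lebesgue_measure_set1.
have dE s : dotv b (s *: xi + y *m B) = enorm b * s.
  rewrite {1}bE dotvZl dotvDr dotvZr xi1 mulr1 [dotv xi (_ *m _)]dotvC.
  by rewrite [dotv (y *m B) _]dotvE -mulmxA Bxi mulmx0 mxE addr0.
apply/seteqP; split=> s; rewrite /line_section /= dE; last by move=> ->;
  rewrite mulr0.
by move/eqP; rewrite mulf_eq0 gt_eqF//= => /eqP.
Qed.

Lemma leb_bigU_null (I : Type) (s : seq I) (F : I -> set 'rV[R]_(m.+1)) :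
  (forall i, measurable (F i)) -> (forall i, leb (F i) = 0%E) ->
  measurable (\big[setU/set0]_(i <- s) F i) /\
  leb (\big[setU/set0]_(i <- s) F i) = 0%E.
Proof.
move=> mF F0; elim: s => [|i s [mU U0]]; first by rewrite big_nil measure0.
rewrite big_cons; split; first exact: measurableU.
apply/eqP; rewrite eq_le measure_ge0 andbT.
by apply: le_trans (measureU2 _ _ _) _ => //; rewrite /= F0 U0 adde0.
Qed.

Lemma le_volume_null A U N : bmeas A -> bmeas U -> measurable N -> leb N = 0%E ->
  A `<=` U `|` N -> volume A <= volume U.
Proof.
move=> bA bU mN N0 AUN; rewrite -lee_fin -!bmeas_leb//.
have mA : measurable A by case: bA.
have mU : measurable U by case: bU.
apply: (@le_trans _ _ (leb (U `|` N))).
  by apply: le_measure; rewrite ?inE//; exact: measurableU.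
by apply: le_trans (measureU2 _ _ _) _ => //; rewrite /= N0 adde0.
Qed.

(** A remainder uniform in [u] is what [le_of_small_perturbation] can absorb. *)
Lemma exprD1_le n : exists2 C : R, 0 <= C &
  forall u, 0 <= u <= 1 -> (1 + u) ^+ n <= 1 + n%:R * u + C * u ^+ 2.
Proof.
elim: n => [|n [C C0 IH]].
  by exists 0 => // u _; rewrite expr0 !mul0r !addr0.
(* Multiplication by 1 + u produces the terms n u^2 + C u^2 + C u^3, and u <= 1. *)
exists (n%:R + 2 * C) => [|u /andP[u0 u1]]; first by rewrite addr_ge0// mulr_ge0.
have := IH u; rewrite u0 u1 => /(_ isT) H.
rewrite exprS -natr1; set X := (1 + u) ^+ n in H *.
have u10 : 0 <= 1 + u by lra.
have : (1 + u) * X <= (1 + u) * (1 + n%:R * u + C * u ^+ 2) by rewrite ler_wpM2l.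
have : 0 <= C * u ^+ 2 * (1 - u) by rewrite !mulr_ge0 ?sqr_ge0// subr_ge0.
move: (n%:R : R) => k; nra.
Qed.

End halfspaces.

Section cauchy_formula.
Context {R : realType} {m : nat} {I : finType}.
Variable a : I -> 'rV[R]_(m.+1).
(** A repeated normal would have an empty facet cone, since the maximum there has to be strict. *)
Hypothesis a_inj : injective a.
Implicit Types (x y : 'rV[R]_(m.+1)).

Definition halfspaces : set 'rV[R]_(m.+1) := [set y | forall i, dotv (a i) y <= 1].

Hypothesis compactP : compact halfspaces.
Local Notation P := halfspaces.

(* The cone over the facet of P with normal vector [a i], with apex 0. *)
Definition facet_cone i : set 'rV[R]_(m.+1) :=
  [set y | [/\ 0 < dotv (a i) y, dotv (a i) y <= 1 &
    forall j, j != i -> dotv (a j) y < dotv (a i) y]].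

(** The facet cone with a relative margin [del] to its walls: a small enough displacement of its
    points leaves the constraints [j != i] satisfied. As [del] decreases to 0 these sets exhaust the
    facet cone. *)
Definition inner_cone (del : R) i : set 'rV[R]_(m.+1) :=
  [set y | [/\ 0 < dotv (a i) y, dotv (a i) y <= 1 &
    forall j, j != i -> dotv (a j) y <= (1 - del) * dotv (a i) y]].

Lemma facet_cone_sub i : facet_cone i `<=` P.
Proof.
move=> y [y0 y1 yj] j; have [->//|ji] := eqVneq j i.
by apply: le_trans y1; apply: ltW; exact: yj.
Qed.

Lemma inner_cone_sub del i : 0 < del -> inner_cone del i `<=` facet_cone i.
Proof.
move=> del0 y [y0 y1 yj]; split => // j /yj /le_lt_trans; apply.
by rewrite mulrBl mul1r gtrBl mulr_gt0.
Qed.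

Lemma measurable_inner_cone del i : measurable (inner_cone del i).
Proof.
rewrite (_ : inner_cone del i = [set y | 0 < dotv (a i) y] `&`
    [set y | dotv (a i) y <= 1] `&` \bigcap_(j in [set: I])
      (if j == i then setT else [set y | dotv (a j - (1 - del) *: a i) y <= 0])).
  apply: measurableI; first apply: measurableI.
  - exact: measurable_dotv_gt.
  - exact: measurable_dotv_le.
  apply: fin_bigcap_measurable => // j _; case: ifP => // _.
  exact: measurable_dotv_le.
apply/seteqP; split=> y.
  move=> [y0 y1 yj]; split=> // j _; case: ifPn => // ji.
  by rewrite /= dotvDl dotvNl dotvZl subr_le0; exact: yj.
move=> [[y0 y1] yj]; split=> // j ji; have := yj j Logic.I; rewrite (negbTE ji) /=.
by rewrite dotvDl dotvNl dotvZl subr_le0.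
Qed.

Lemma inner_coneS del del' i : del' <= del ->
  inner_cone del i `<=` inner_cone del' i.
Proof.
move=> dd y [y0 y1 yj]; split => // j /yj /le_trans; apply.
by rewrite ler_pM2r// lerD2l lerN2.
Qed.

Lemma facet_coneE i : facet_cone i = \bigcup_k inner_cone k.+1%:R^-1 i.
Proof.
apply/seteqP; split=> [y [y0 y1 yj]|y [k _]]; last exact: inner_cone_sub.
have : \forall k \near \oo, forall j, j != i ->
    dotv (a j) y <= (1 - k.+1%:R^-1) * dotv (a i) y.
  apply: filter_forall => j; have [->|ji] := eqVneq j i; first exact: nearW.
  have r0 : 0 < 1 - dotv (a j) y / dotv (a i) y.
    by rewrite subr_gt0 ltr_pdivrMr// mul1r; exact: yj.
  have := near_infty_natSinv_lt (PosNum r0); apply: filterS => k /= kr _.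
  by rewrite -ler_pdivrMr// lerBrDl -lerBrDr ltW.
by case=> k _ /(_ k (leqnn k)) H; exists k.
Qed.

Lemma measurable_facet_cone i : measurable (facet_cone i).
Proof. by rewrite facet_coneE; apply: bigcupT_measurable => k;
  exact: measurable_inner_cone. Qed.

Lemma bmeas_facet_cone i : bmeas (facet_cone i).
Proof.
by apply: (bmeas_sub _ (@facet_cone_sub i));
  [exact: measurable_facet_cone|exact: compact_bmeas].
Qed.

Lemma bmeas_inner_cone del i : 0 < del -> bmeas (inner_cone del i).
Proof.
move=> d0; apply: (bmeas_sub _ (@inner_cone_sub del i d0));
  first exact: measurable_inner_cone.
exact: bmeas_facet_cone.
Qed.

Lemma volume_inner_cone_cvg i :
  volume (inner_cone k.+1%:R^-1 i) @[k --> \oo] --> volume (facet_cone i).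
Proof.
apply: fine_cvg; rewrite -bmeas_leb; last exact: bmeas_facet_cone.
rewrite facet_coneE; apply: nondecreasing_cvg_mu.
- by move=> k; exact: measurable_inner_cone.
- by apply: bigcupT_measurable => k; exact: measurable_inner_cone.
- move=> k l kl; apply/subsetPset => y; apply: (@inner_coneS k.+1%:R^-1).
  by rewrite lef_pV2 ?posrE// ler_nat ltnS.
Qed.

Lemma facet_cone_disjoint i j : i != j -> facet_cone i `&` facet_cone j = set0.
Proof.
move=> ij; apply/seteqP; split=> // y [[_ _ yi] [_ _ yj]].
by have := yi j; rewrite eq_sym ij => /(_ isT); have := yj i ij; lra.
Qed.

Lemma sum_facet_cone_le : \sum_i volume (facet_cone i) <= volume P.
Proof.
rewrite -volume_bigU; [|exact: bmeas_facet_cone|exact: facet_cone_disjoint].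
apply: le_volume.
- by have [] := bmeas_bigU (index_enum I) bmeas_facet_cone.
- exact: compact_bmeas.
- by rewrite -bigcup_seq => y [i _]; exact: facet_cone_sub.
Qed.

Lemma halfspaces_convex : convex P.
Proof.
move=> x y t Px Py /andP[t0 t1] i; rewrite dotvDr !dotvZr.
by have := Px i; have := Py i; nra.
Qed.

(** Otherwise the whole ray through [y] would stay in [P], which is bounded. *)
Lemma halfspaces_pos y : y != 0 -> exists i, 0 < dotv (a i) y.
Proof.
move=> y0; apply: contrapT => /forallNP neg.
have [_ [r Pr]] := compact_bmeas compactP.
have [j yj] : exists j, y ord0 j != 0.
  apply: contrapT => /forallNP yj; move/eqP: y0; apply; apply/rowP => j.
  by rewrite mxE; apply/eqP; apply: contrapT => /negP; exact: yj.
pose c := (`|r| + 1) / `|y ord0 j|.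
have yj0 : 0 < `|y ord0 j| by rewrite normr_gt0.
have c0 : 0 < c by rewrite divr_gt0// ltr_pwDr.
have : P (c *: y).
  move=> i; rewrite dotvZr; have := neg i => /negP; rewrite -leNgt => ay.
  by apply: le_trans ler01; rewrite pmulr_rle0.
move=> /Pr /(_ j); rewrite mxE normrM gtr0_norm// divfK ?gt_eqF//.
by have := ler_norm r; lra.
Qed.

(* A null set outside of which a single [dotv (a i) y] is maximal; the case
   [None] only serves to remove the origin. *)
Let ties : set 'rV[R]_(m.+1) :=
  \big[setU/set0]_(p <- index_enum (option (I * I)%type))
  match p with
  | None => [set y | dotv (delta_mx ord0 ord0) y = 0]
  | Some ij => if ij.1 == ij.2 then set0 else [set y | dotv (a ij.1 - a ij.2) y = 0]
  end.

Let ties_null : measurable ties /\ leb ties = 0%E.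
Proof.
apply: leb_bigU_null => -[[i j]|] /=.
- by case: ifP => // _; exact: measurable_hyperplane.
- exact: measurable_hyperplane.
- case: ifPn => [_|ij]; first exact: measure0.
  by apply: leb_hyperplane; rewrite subr_eq0; apply: contra ij => /eqP/a_inj ->.
- apply: leb_hyperplane; apply/eqP => /rowP /(_ ord0); rewrite !mxE !eqxx.
  by move/eqP; rewrite oner_eq0.
Qed.

Let facet_coneP y : ~ ties y -> exists i, 0 < dotv (a i) y /\
  forall j, j != i -> dotv (a j) y < dotv (a i) y.
Proof.
move=> yt.
have tiesP p : ~ match p with
  | None => [set y | dotv (delta_mx ord0 ord0) y = 0]
  | Some ij => if ij.1 == ij.2 then set0 else [set y | dotv (a ij.1 - a ij.2) y = 0]
  end y.
  move=> Hp; apply: yt; rewrite /ties -bigcup_seq; exists p => //=.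
  by rewrite mem_index_enum.
have y0 : y != 0 by apply/eqP => y0; apply: (tiesP None); rewrite y0 /= dotv0r.
have [i0 i0y] := halfspaces_pos y0.
pose i := [arg max_(i > i0) dotv (a i) y]%O.
have imax j : dotv (a j) y <= dotv (a i) y by rewrite /i;
  case: arg_maxP => // k _; apply.
exists i; split; first exact: lt_le_trans (imax i0).
move=> j ji; rewrite lt_neqAle imax andbT; apply/eqP => ayE.
by apply: (tiesP (Some (j, i))); rewrite /= (negbTE ji) /= dotvDl dotvNl ayE subrr.
Qed.

(* Up to a null set, P + [0, t x] is covered by the cones over the facets, each
   dilated by the largest factor that x can cause. *)
Lemma volume_halfspaces_seg_le x t : 0 <= t ->
  volume (mink_sum P (seg (t *: x))) <=
  \sum_i (1 + t * Num.max 0 (dotv (a i) x)) ^+ m.+1 * volume (facet_cone i).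
Proof.
move=> t0; pose c i := 1 + t * Num.max 0 (dotv (a i) x).
have c1 i : 1 <= c i by rewrite lerDl mulr_ge0// le_max lexx.
have c0 i : 0 < c i by apply: lt_le_trans (c1 i).
have bF i : bmeas (dilate (c i) (facet_cone i)).
  by apply: bmeas_dilate; [rewrite gt_eqF|exact: bmeas_facet_cone].
apply: (@le_trans _ _ (volume (\big[setU/set0]_i dilate (c i) (facet_cone i))));
  last first.
  apply: le_trans (le_volume_bigU bF) _; apply: ler_sum => i _.
  by rewrite volume_dilate//; exact: measurable_facet_cone.
have [mt lt0] := ties_null.
apply: (le_volume_null _ _ mt lt0).
- by apply: compact_bmeas; apply: mink_sum_compact => //; exact: seg_compact.
- exact: bmeas_bigU.
move=> _ [w Pw [_ [u + <-] <-]]; rewrite /= in_itv/= => /andP[u0 u1].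
set y := w + _; have [yt|yt] := pselect (ties y); [by right|left].
have [i [iy imax]] := facet_coneP yt.
rewrite -bigcup_seq; exists i; first by rewrite /= mem_index_enum.
exists ((c i)^-1 *: y); last by rewrite scalerA mulfV ?scale1r// gt_eqF.
split=> [||j ji]; rewrite !dotvZr ?mulr_gt0 ?invr_gt0//; last first.
  by rewrite ltr_pM2l ?invr_gt0//; exact: imax.
rewrite mulrC ler_pdivrMr// mul1r /y dotvDr !dotvZr /c.
apply: lerD; first exact: Pw.
rewrite mulrCA; apply: ler_wpM2l => //.
have [ax|ax] := leP 0 (dotv (a i) x).
  by rewrite ler_piMl.
by apply: mulr_ge0_le0 => //; exact: ltW.
Qed.

(** The preceding bound is expanded to first order in t. The facet cones are disjoint in [P], so the
    terms of order 0 are at most the volume of [P]. *)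
Lemma swept_halfspaces_le x : swept P x <=
  m.+1%:R * \sum_i Num.max 0 (dotv (a i) x) * volume (facet_cone i).
Proof.
pose b i := Num.max 0 (dotv (a i) x).
have b0 i : 0 <= b i by rewrite le_max lexx.
have [C C0 HC] := @exprD1_le R m.+1.
pose s := \sum_i b i; have s0 : 0 <= s by apply: sumr_ge0.
(* For t <= 1 / (1 + s) every t b_i is at most 1, the range of [exprD1_le]. *)
apply: (@le_of_small_perturbation _ _ _ (C * \sum_i b i ^+ 2 * volume (facet_cone
  i)) (1 + s)^-1).
  by rewrite invr_gt0 ltr_pwDl.
move=> t /andP[t0 t1]; rewrite -(ler_pM2l t0) -sweptZ ?(ltW t0)//;
  last exact: halfspaces_convex.
rewrite /swept lerBlDr; apply: le_trans (volume_halfspaces_seg_le x (ltW t0)) _.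
rewrite -lerBlDr; apply: (@le_trans _ _ (\sum_i (1 + t * b i) ^+ m.+1 * volume
  (facet_cone i)
    - \sum_i volume (facet_cone i))).
  by rewrite lerD2l lerN2 sum_facet_cone_le.
rewrite -sumrB !mulrDr mulrCA [t * (t * _)]mulrA [t * t * _]mulrCA !mulr_sumr
  -big_split.
apply: ler_sum => i _ /=.
have bs : b i <= s by rewrite /s (bigD1 i)//= lerDl sumr_ge0.
have /HC : 0 <= t * b i <= 1.
  rewrite mulr_ge0 ?(ltW t0)//=; apply: (@le_trans _ _ ((1 + s)^-1 * (1 + s))).
    by apply: ler_pM => //; [exact: ltW|rewrite (le_trans bs)// lerDr].
  by rewrite mulVf// gt_eqF// ltr_pwDl.
rewrite -/(b i); have := volume_ge0 (facet_cone i).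
move: (volume _) ((1 + t * b i) ^+ m.+1) => v X v0 HX.
have : X * v <= (1 + m.+1%:R * (t * b i) + C * (t * b i) ^+ 2) * v by rewrite
  ler_wpM2r.
by rewrite -subr_ge0 => H; rewrite -subr_ge0; apply: le_trans H _;
  rewrite le_eqVlt; apply/orP; left; apply/eqP; ring.
Qed.

(* The shells [(1 + t b_i) C_i \ C_i] over the inner cones C_i are disjoint and,
   for small t, contained in P + [0, t x]: being away from the walls of the cone,
   their points can be pulled back into P along x. *)
Lemma swept_halfspaces_ge x del : 0 < del <= 1 ->
  m.+1%:R * (\sum_i Num.max 0 (dotv (a i) x) * volume (inner_cone del i)) <=
    swept P x.
Proof.
move=> /andP[d0 d1]; pose b i := Num.max 0 (dotv (a i) x).
have b0 i : 0 <= b i by rewrite le_max lexx.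
pose s := \sum_i `|dotv (a i) x|; have s0 : 0 <= s by apply: sumr_ge0.
have axs i : `|dotv (a i) x| <= s by rewrite /s (bigD1 i)//= lerDl sumr_ge0.
have bs i : b i <= s by rewrite ge_max s0/= (le_trans (ler_norm _)).
have s21 : 0 < 1 + 2 * s by rewrite ltr_pwDl// mulr_ge0.
(* On a shell the other constraints are at most (1 - del)(1 + t s), and pulling back by at most t
   along [x] adds at most t s; since 2 t s <= del, the total stays at most 1. *)
pose t := del / (1 + 2 * s).
have t0 : 0 < t by rewrite divr_gt0.
have ts : t * (1 + 2 * s) = del by rewrite divfK// gt_eqF.
pose c i := 1 + t * b i.
have c1 i : 1 <= c i by rewrite lerDl mulr_ge0// ltW.
have c0 i : 0 < c i by apply: lt_le_trans (c1 i).
pose C i := inner_cone del i.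
have bC i : bmeas (C i) by exact: bmeas_inner_cone.
have bcC i : bmeas (dilate (c i) (C i)) by apply: bmeas_dilate => //;
  rewrite gt_eqF.
pose S i := dilate (c i) (C i) `\` C i.
have mS i : measurable (S i) by apply: measurableD; [case: (bcC i)|case: (bC i)].
have bS i : bmeas (S i).
  by apply: (bmeas_sub (mS i) _ (bcC i)); exact: subDsetl.
have CcC i : C i `<=` dilate (c i) (C i).
  move=> y [y0 y1 yj]; exists ((c i)^-1 *: y);
    last by rewrite scalerA mulfV ?scale1r// gt_eqF.
  split=> [||j ji]; rewrite !dotvZr ?mulr_gt0 ?invr_gt0//.
    by rewrite mulrC ler_pdivrMr// mul1r (le_trans y1).
  by rewrite mulrCA ler_pM2l ?invr_gt0//; exact: yj.
have vS i : m.+1%:R * (t * b i) * volume (C i) <= volume (S i).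
  have : volume (dilate (c i) (C i)) = volume (S i) + volume (C i).
    rewrite -volumeU//; last by rewrite /S setDE -setIA setICl setI0.
    by rewrite /S setDKU.
  rewrite volume_dilate//; last by case: (bC i).
  move=> /eqP; rewrite -subr_eq => /eqP <-.
  rewrite -[X in _ - X]mul1r -mulrBl; apply: ler_wpM2r; first exact: volume_ge0.
  (* Bernoulli: c_i^(m+1) - 1 >= (m+1) t b_i. *)
  have := @exprS_tangent R (c i) 1 m (ltW (c0 i)) ler01.
  by rewrite !expr1n !mulr1 {1}/c -natr1 ; lra.
have SP i : S i `&` P = set0.
  apply/seteqP; split=> // y [[[z [z0 z1 zj] <-] nC] Py]; apply: nC.
  split; rewrite ?dotvZr ?mulr_gt0//; last first.
    by move=> j ji; rewrite dotvZr mulrCA ler_pM2l//; exact: zj.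
  by have := Py i; rewrite dotvZr.
have SS i j : i != j -> S i `&` S j = set0.
  move=> ij; apply/seteqP; split=> // y [[[z Cz zy] _] [[w Cw wy] _]].
  have {}Cz := inner_cone_sub d0 Cz; have {}Cw := inner_cone_sub d0 Cw.
  have : dotv (a j) y < dotv (a i) y.
    by rewrite -zy !dotvZr ltr_pM2l//; case: Cz => _ _; apply; rewrite eq_sym.
  have : dotv (a i) y < dotv (a j) y.
    by rewrite -wy !dotvZr ltr_pM2l//; case: Cw => _ _; apply.
  by move=> /lt_trans /[apply]; rewrite ltxx.
have SPx i : S i `<=` mink_sum P (seg (t *: x)).
  move=> _ [[z [z0 z1 zj] <-] nC].
  set y := c i *: z; have yE j : dotv (a j) y = c i * dotv (a j) z by rewrite
    dotvZr.
  have y1 : 1 < dotv (a i) y.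
    rewrite ltNge; apply/negP => y1; apply: nC; split=> //;
      first by rewrite yE mulr_gt0.
    by move=> j ji; rewrite !yE mulrCA ler_pM2l//; exact: zj.
  have yc : dotv (a i) y <= c i by rewrite yE -[leRHS]mulr1 ler_pM2l.
  have bi0 : 0 < b i.
    rewrite lt_neqAle b0 andbT; apply/eqP => b00.
    by move: (lt_le_trans y1 yc); rewrite /c -b00 mulr0 addr0 ltxx.
  have bE : b i = dotv (a i) x.
    by move: bi0; rewrite /b lt_max ltxx /= => /ltW/max_idPr.
  (* The displacement along [x] that brings the violated constraint [i] back to exactly 1. *)
  pose u := (dotv (a i) y - 1) / b i.
  have u0 : 0 <= u by rewrite divr_ge0 ?subr_ge0 ?ltW.
  have ut : u <= t by rewrite ler_pdivrMr// lerBlDl.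
  exists (y - u *: x); last first.
    exists (u *: x); last by rewrite subrK.
    exists (u / t); last by rewrite scalerA divfK// gt_eqF.
    by rewrite /= in_itv/= divr_ge0 ?(ltW t0)//= ler_pdivrMr// mul1r.
  move=> j; rewrite dotvDr dotvNr dotvZr; have [->|ji] := eqVneq j i.
    by rewrite -bE divfK ?gt_eqF// subKr.
  have h1 : dotv (a j) y <= (1 - del) * c i.
    rewrite yE mulrC; apply: le_trans (ler_wpM2r (ltW (c0 i)) (zj j ji)) _.
    rewrite -mulrA; apply: ler_wpM2l; first by rewrite subr_ge0.
    by rewrite mulrC -yE.
  have h2 : - (u * dotv (a j) x) <= t * s.
    apply: le_trans (ler_norm _) _; rewrite normrN normrM ger0_norm//.
    exact: ler_pM.
  have h3 : t * b i <= t * s by rewrite ler_pM2l.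
  have h4 : 0 <= del * (t * b i) by apply: mulr_ge0; [exact: ltW|apply: mulr_ge0;
    exact: ltW].
  move: h1 h2 h3 h4 ts; rewrite /c; lra.
have tot : volume P + \sum_i volume (S i) <= volume (mink_sum P (seg (t *: x))).
  rewrite -volume_bigU// -volumeU; [|exact: compact_bmeas|exact: bmeas_bigU|];
    last first.
    apply/seteqP; split=> // y [Py]; rewrite -bigcup_seq => -[i _ Siy].
    by have /seteqP[+ _] := SP i; apply; split; [exact: Siy|].
  apply: le_volume.
  - apply: measurableU; first exact: compact_measurable_rV.
    by have [] := bmeas_bigU (index_enum I) bS.
  - by apply: compact_bmeas; apply: mink_sum_compact => //; exact: seg_compact.
  - move=> y [Py|]; first by exists y => //; exists 0; [exact: seg0|rewrite addr0].
    by rewrite -bigcup_seq => -[i _ /SPx].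
rewrite -(ler_pM2l t0) -sweptZ ?(ltW t0)//; last exact: halfspaces_convex.
rewrite /swept lerBrDl; apply: le_trans tot; rewrite lerD2l !mulr_sumr.
apply: ler_sum => i _; apply: le_trans (vS i).
by rewrite le_eqVlt; apply/orP; left; apply/eqP; rewrite /b /C; ring.
Qed.

(** The upper bound is direct. The lower one holds for the inner cones of margin 1 / (k+1), whose
    volumes tend to those of the facet cones. *)
Theorem cauchy_projection_formula x : swept P x =
  m.+1%:R * \sum_i Num.max 0 (dotv (a i) x) * volume (facet_cone i).
Proof.
apply/eqP; rewrite eq_le swept_halfspaces_le /=.
pose u k := m.+1%:R * \sum_i Num.max 0 (dotv (a i) x) * volume (inner_cone
  k.+1%:R^-1 i).
have cu : u k @[k --> \oo] -->
    m.+1%:R * \sum_i Num.max 0 (dotv (a i) x) * volume (facet_cone i).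
  apply: cvgMl_tmp; apply: cvg_big; first exact: add_continuous.
  by move=> i _; apply: cvgMl_tmp; exact: volume_inner_cone_cvg.
apply: (cvgr_to_le cu); apply: nearW => k; apply: swept_halfspaces_ge.
by rewrite invr_gt0 ltr0n/= invf_le1// ler1n.
Qed.

End cauchy_formula.

(** * Zonotopes and projection bodies *)

Section zonotopes.
Context {R : realType} {m : nat}.
Implicit Types (x z u : 'rV[R]_(m.+1)) (K L M A : set 'rV[R]_(m.+1)) (s : seq
  'rV[R]_(m.+1)).

Definition add_segs K s := foldr (fun z A => mink_sum A (seg z)) K s.

(* Segments are issued from 0; no centring is needed below, because the support
   function of the zonotope used there is a projection function, hence even. *)
Definition zonotope s := add_segs [set 0] s.

Lemma add_segs_compact K s : compact K -> compact (add_segs K s).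
Proof.
move=> cK; elim: s => //= z s IH; apply: mink_sum_compact => //; exact: seg_compact.
Qed.

Lemma add_segs_convex K s : convex K -> convex (add_segs K s).
Proof.
move=> cK; elim: s => //= z s IH; apply: mink_sum_convex => //; exact: seg_convex.
Qed.

Lemma add_segsE K s : add_segs K s = mink_sum K (zonotope s).
Proof. by elim: s => [|z s IH]; rewrite /= ?mink_sum0// mink_sumA -IH. Qed.

Lemma sub_add_segs K s : K `<=` add_segs K s.
Proof.
elim: s => //= z s IH y /IH Ky; exists y => //; exists 0;
  [exact: seg0|exact: addr0].
Qed.

Lemma zonotope_compact s : compact (zonotope s).
Proof. by apply: add_segs_compact; exact: compact_set1. Qed.

Lemma zonotope_convex s : convex (zonotope s).
Proof.
by apply: add_segs_convex => x y t -> -> _; rewrite /= !scaler0 addr0.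
Qed.

Lemma dilate_zonotope (t : R) s : dilate t (zonotope s) = zonotope [seq t *: z |
  z <- s].
Proof.
elim: s => [|z s IH] /=;
  last by rewrite dilate_mink_sum dilate_seg -/(zonotope s) IH.
by apply/seteqP; split=> [_ [_ -> <-]|_ ->]; rewrite ?scaler0//; exists 0;
  rewrite ?scaler0.
Qed.

(** Telescoping: adding one segment at a time, each increment is [swept] of an intermediate body,
    hence at most [swept A]. With the reverse bound [volume_add_segs_ge] this replaces the
    polynomial expansion of |K + t Z|. *)
Lemma volume_add_segs_le K A s : compact K -> convex K -> compact A -> convex A ->
  add_segs K s `<=` A -> volume (add_segs K s) <= volume K + \sum_(z <- s) swept
    A z.
Proof.
move=> cK vK cA vA; elim: s => [_|z s IH KA] /=; first by rewrite big_nil addr0.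
have sub : add_segs K s `<=` A.
  by move=> y Ky; apply: KA; exists y => //; exists 0; [exact: seg0|rewrite addr0].
rewrite big_cons addrCA -lerBlDr; apply: (@le_trans _ _ (swept (add_segs K s) z)).
  by rewrite /swept lerD2l lerN2 IH.
by apply: swept_mono => //; [exact: add_segs_compact|exact: add_segs_convex].
Qed.

Lemma volume_add_segs_ge K s : compact K -> convex K ->
  volume K + \sum_(z <- s) swept K z <= volume (add_segs K s).
Proof.
move=> cK vK; elim: s => [|z s IH] /=; first by rewrite big_nil addr0.
rewrite big_cons addrCA -lerBrDr; apply: (@le_trans _ _ (swept (add_segs K s) z)).
  apply: swept_mono => //; [exact: add_segs_compact|exact: add_segs_convex|].
  exact: sub_add_segs.
by rewrite /swept lerD2l lerN2.
Qed.

(** With [zonotope_dotv_max] this identifies the support function of the zonotope: a segment [0, z]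
    contributes the positive part of [dotv z u], as in Cauchy's formula. *)
Lemma zonotope_dotv_le s y u : zonotope s y ->
  dotv u y <= \sum_(z <- s) Num.max 0 (dotv z u).
Proof.
elim: s y => [y ->|z s IH /= y]; first by rewrite dotv0r big_nil.
move=> [w Zw [_ [t + <-] <-]]; rewrite /= in_itv/= => /andP[t0 t1].
rewrite big_cons dotvDr addrC; apply: lerD; last exact: IH.
rewrite dotvZr dotvC; have [zu|zu] := leP 0 (dotv z u); first by rewrite ler_piMl.
by apply: mulr_ge0_le0 => //; exact: ltW.
Qed.

Lemma zonotope_dotv_max s u : exists2 y, zonotope s y &
  dotv u y = \sum_(z <- s) Num.max 0 (dotv z u).
Proof.
elim: s => [|z s [y Zy yE]]; first by exists 0 => //; rewrite dotv0r big_nil.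
rewrite big_cons; have [zu|zu] := leP 0 (dotv z u).
  exists (y + z); first by exists y => //; exists z => //; exact: seg1.
  by rewrite dotvDr yE addrC dotvC.
exists (y + 0); first by exists y => //; exists 0 => //; exact: seg0.
by rewrite addr0 yE add0r.
Qed.

(* Minkowski's first inequality, from Brunn-Minkowski by letting t tend to 0 in
   |K + t L| <= |K + t Z|. *)
Lemma minkowski_zonotope K L s (k l rho : R) : compact K -> convex K -> 0 < rho ->
  cube rho `<=` K -> compact L -> L !=set0 -> L `<=` zonotope s ->
  0 <= k -> 0 <= l -> volume K = k ^+ m.+1 -> volume L = l ^+ m.+1 ->
  m.+1%:R * k ^+ m * l <= \sum_(z <- s) swept K z.
Proof.
move=> cK vK rho0 rhoK cL L0 LZ k0 l0 kE lE; set S := \sum_(z <- s) _.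
have S0 : 0 <= S by apply: sumr_ge0 => z _; exact: swept_ge0.
have [_ [r Zr]] := compact_bmeas (@zonotope_compact s).
(* Large enough for Z to lie in c K; then K + t Z lies in (1 + t c) K, the body against which all
   increments are estimated. *)
pose c := (`|r| + 1) / rho.
have c0 : 0 < c by rewrite divr_gt0// ltr_pwDr.
have ZcK : zonotope s `<=` dilate c K.
  move=> y /Zr yr; exists (c^-1 *: y);
    last by rewrite scalerA mulfV ?scale1r// gt_eqF.
  apply: rhoK => i; rewrite mxE normrM gtr0_norm ?invr_gt0// mulrC ler_pdivrMr// /c.
  rewrite mulrC divfK ?gt_eqF// (le_trans (yr i))// (le_trans (ler_norm _))//.
  by rewrite lerDl.
have [C C0 HC] := @exprD1_le R m.
have K0 : K !=set0 by exists 0; apply: rhoK; apply: cube0; exact: ltW.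
apply: (@le_of_small_perturbation _ _ _ ((m%:R * c + C * c) * S) c^-1);
  first by rewrite invr_gt0.
move=> t /andP[t0 tc].
have tc0 : 0 < t * c by rewrite mulr_gt0.
have tc1 : t * c <= 1 by rewrite -ler_pdivlMr// mul1r.
have lower : (k + t * l) ^+ m.+1 <= volume (add_segs K [seq t *: z | z <- s]).
  apply: (@le_trans _ _ (volume (mink_sum K (dilate t L)))).
    apply: brunn_minkowski => //.
    - exact: dilate_compact.
    - by have [x Lx] := L0; exists (t *: x), x.
    - by rewrite mulr_ge0// ltW.
    - by rewrite kE.
    - by rewrite volume_dilate// ?lE ?exprMn//; exact: compact_measurable_rV.
  apply: le_volume.
  - by apply: compact_measurable_rV; apply: mink_sum_compact => //;
    exact: dilate_compact.
  - by apply: compact_bmeas; exact: add_segs_compact.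
  - by rewrite add_segsE -dilate_zonotope; apply: mink_sumS => //; exact: dilateS.
have upper : volume (add_segs K [seq t *: z | z <- s]) <=
    k ^+ m.+1 + t * ((1 + t * c) ^+ m * S).
  apply: le_trans (@volume_add_segs_le K (dilate (1 + t * c) K) _ cK vK _ _ _) _.
  - exact: dilate_compact.
  - exact: dilate_convex.
  - rewrite add_segsE -dilate_zonotope -mink_sum_scale// dilate1;
    apply: mink_sumS => //.
    by rewrite -dilateA; exact: dilateS.
  rewrite kE lerD2l big_map !mulr_sumr; apply: ler_sum => z _.
  rewrite sweptZ ?(ltW t0)//; [|exact: dilate_compact|exact: dilate_convex].
  by rewrite swept_dilate// addr_gt0.
(* The tangent at [k] extracts the first-order term (m+1) k^m t l of the Brunn-Minkowski bound. *)
have tan := @exprS_tangent R (k + t * l) k m (addr_ge0 k0 (mulr_ge0 (ltW t0) l0))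
  k0.
have : t * (m.+1%:R * k ^+ m * l) <= t * ((1 + t * c) ^+ m * S).
  have := le_trans lower upper; move: tan; rewrite [k ^+ m.+1]exprS -[m.+1%:R]natr1.
  by move: ((k + t * l) ^+ m.+1) (t * (_ * S)) (k ^+ m) => X Y Z; nra.
rewrite ler_pM2l// => /le_trans; apply.
have := HC (t * c); rewrite (ltW tc0) tc1 => /(_ isT) H.
have H2 : C * (t * c) ^+ 2 <= C * (t * c) by rewrite expr2 ler_wpM2l// ler_piMl//
  ltW.
have H3 : (1 + t * c) ^+ m <= 1 + t * (m%:R * c + C * c) by move: H H2; lra.
apply: le_trans (ler_wpM2r S0 H3) _.
by rewrite le_eqVlt; apply/orP; left; apply/eqP; ring.
Qed.

Lemma zonotope_swept_le L s (lam : R) : compact L -> convex L -> 0 < lam ->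
  zonotope s `<=` dilate lam L ->
  \sum_(z <- s) swept L z <= m.+1%:R * lam * volume L.
Proof.
move=> cL vL lam0 ZL; set S := \sum_(z <- s) _.
have [C C0 HC] := @exprD1_le R m.+1.
apply: (@le_of_small_perturbation _ _ _ (C * lam ^+ 2 * volume L) lam^-1);
  first by rewrite invr_gt0.
move=> t /andP[t0 tl].
have tl0 : 0 < t * lam by rewrite mulr_gt0.
have tl1 : t * lam <= 1 by rewrite -ler_pdivlMr// mul1r.
have lower : volume L + t * S <= volume (add_segs L [seq t *: z | z <- s]).
  apply: le_trans (volume_add_segs_ge _ cL vL).
  by rewrite lerD2l big_map mulr_sumr; apply: ler_sum => z _;
    rewrite sweptZ ?(ltW t0).
have upper : volume (add_segs L [seq t *: z | z <- s]) <= (1 + t * lam) ^+ m.+1 *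
  volume L.
  rewrite -volume_dilate ?addr_gt0//; last exact: compact_measurable_rV.
  apply: le_volume.
  - by apply: compact_measurable_rV; exact: add_segs_compact.
  - by apply: compact_bmeas; exact: dilate_compact.
  - rewrite add_segsE -dilate_zonotope -mink_sum_scale// dilate1;
    apply: mink_sumS => //.
    by rewrite -dilateA; exact: dilateS.
have := HC (t * lam); rewrite (ltW tl0) tl1 => /(_ isT) H.
have V0 := volume_ge0 L.
rewrite -(ler_pM2l t0).
have := le_trans lower upper; have := ler_wpM2r V0 H.
move: (volume L) => V; move: ((1 + t * lam) ^+ m.+1 * V) => X; lra.
Qed.

Lemma support_functionP L u : compact L -> L !=set0 ->
  (forall y, L y -> dotv u y <= support_function L u) /\
  exists2 y, L y & dotv u y = support_function L u.
Proof.
move=> cL L0.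
have [y + yP] := EVT_max_rV L0 cL (continuous_subspaceT (@continuous_id_dotv _ _
  u)).
rewrite inE => Ly.
have yub x : L x -> dotv u x <= dotv u y by move=> Lx; apply: yP; rewrite inE.
suff -> : support_function L u = dotv u y by split => //; exists y.
apply/eqP; rewrite eq_le; apply/andP; split.
  by apply: ge_sup; [exists (dotv u y), y|move=> _ [x Lx <-]; exact: yub].
by apply: sup_ubound; [exists (dotv u y) => _ [x Lx <-]; exact: yub|exists y].
Qed.

(** Indexing by [seq_sub D] discards repetitions, which gives the injective family of normals
    required by Cauchy's formula. *)
Lemma polytope_halfspaces (D : seq 'rV[R]_(m.+1)) :
  polytope D = halfspaces (fun i : seq_sub D => ssval i).
Proof.
apply/seteqP; split=> y Py; first by move=> i; apply: Py; exact: ssvalP.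
by move=> a aD; exact: (Py (SeqSub aD)).
Qed.

(** If P is the polytope around [M], then p_M <= p_P <= lam p_M, where p_M and p_P are the support
    functions of [L] and of the zonotope. Separation turns these inequalities into inclusions. *)
Lemma projection_body_zonotope M L (rho lam : R) : compact M -> convex M ->
  0 < rho -> cube rho `<=` M -> compact L -> convex L -> L !=set0 ->
  (forall u, (forall y, L y -> dotv u y <= swept M u) /\
     exists2 y, L y & dotv u y = swept M u) ->
  1 < lam -> exists s, L `<=` zonotope s /\ zonotope s `<=` dilate lam L.
Proof.
move=> cM vM rho0 rhoM cL vL L0 hL lam1.
have lam0 : 0 < lam by apply: lt_trans lam1.
(* Dilating [M] by q multiplies p_M by q^m. The root of order m + 1 also makes sense for m = 0, and
   q^m <= q^(m+1) = lam. *)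
have [q q0 qE] := exists_nth_root (ltn0Sn m) (ltW lam0).
have q1 : 1 < q.
  rewrite ltNge; apply/negP => q1; have := exprn_ile1 m.+1 q0 q1.
  by rewrite qE leNgt lam1.
have qm : q ^+ m <= lam by rewrite -qE exprS ler_peMl ?exprn_ge0// ltW.
have q10 : 0 < q - 1 by rewrite subr_gt0.
have [D [MP PM]] := polytope_approx cM vM rho0 rhoM q10.
rewrite addrC subrK in PM.
have q0' : 0 < q by apply: lt_trans q1.
have cMq : compact (dilate q M) by exact: dilate_compact.
have vMq : convex (dilate q M) by exact: dilate_convex.
have cP : compact (polytope D).
  rewrite (_ : polytope D = dilate q M `&` polytope D).
    by apply: compact_closedI => //; exact: polytope_closed.
  by apply/seteqP; split=> y; [move=> Py; split => //; exact: PM|case].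
have vP : convex (polytope D) by exact: polytope_convex.
have MPs u : swept M u <= swept (polytope D) u by exact: swept_mono.
have PMs u : swept (polytope D) u <= lam * swept M u.
  apply: le_trans (swept_mono u cP vP cMq vMq PM) _; rewrite swept_dilate//.
  by apply: ler_wpM2r => //; exact: swept_ge0.
pose a (i : seq_sub D) := ssval i.
have a_inj : injective a by exact: val_inj.
have PE : polytope D = halfspaces a by exact: polytope_halfspaces.
have cH : compact (halfspaces a) by rewrite -PE.
pose s := [seq (m.+1%:R * volume (facet_cone a i)) *: a i | i <- index_enum
  (seq_sub D)].
have sE u : \sum_(z <- s) Num.max 0 (dotv z u) = swept (polytope D) u.
  rewrite PE (cauchy_projection_formula a_inj cH) /s big_map mulr_sumr.
  apply: eq_bigr => i _; rewrite dotvZl -mulrA.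
  have w0 : 0 <= m.+1%:R * volume (facet_cone a i) by rewrite mulr_ge0 ?volume_ge0.
  by rewrite -[X in Num.max X _](mulr0 (m.+1%:R * volume (facet_cone a i))) mulrA
    -maxr_pMr// -mulrA [_ * Num.max _ _]mulrC.
exists s; split=> y.
  move=> Ly; apply: contrapT => Zy.
  have [u uP] := separation (@zonotope_compact s) (@zonotope_convex s) Zy.
  have [z Zz zE] := zonotope_dotv_max s u.
  have := uP _ Zz; rewrite zE sE; have := (hL u).1 _ Ly; have := MPs u; lra.
move=> Zy; apply: contrapT => Ly.
have cLl : compact (dilate lam L) by exact: dilate_compact.
have vLl : convex (dilate lam L) by exact: dilate_convex.
have [u uP] := separation cLl vLl Ly.
have [z Lz zE] := (hL u).2.
have := uP (lam *: z) (ex_intro2 _ _ z Lz erefl).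
rewrite dotvZr zE; have := zonotope_dotv_le u Zy; rewrite sE.
have := PMs u; lra.
Qed.

Lemma interior_cube A x : A° x ->
  exists2 r : R, 0 < r & forall y, cube r (y - x) -> A y.
Proof.
move=> /nbhs_ballP[e /= e0 eA]; exists (e / 2); first by rewrite divr_gt0.
move=> y yx; apply: eA; rewrite -ball_normE /= -normrN opprB.
apply: (@le_lt_trans _ _ (e / 2)); last by rewrite ltr_pdivrMr//; lra.
by apply: normr_rV_le => //; rewrite divr_ge0 ?ltW.
Qed.

(** Around an interior point [x], both [x + y] and [x - y] are in [A] for small [y]; then [y] is the
    midpoint of [x + y] and the opposite of [x - y]. *)
Lemma symmetric_cube A : convex A -> origin_symmetric A -> A° !=set0 ->
  exists2 r : R, 0 < r & cube r `<=` A.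
Proof.
move=> vA sA [x /interior_cube[r r0 rA]]; exists r => // y yr.
have A1 : A (x + y) by apply: rA; rewrite addrAC subrr add0r.
have A2 : A (- (x - y)).
  by apply/sA/rA; rewrite addrAC subrr add0r => i; rewrite mxE normrN.
have -> : y = 2^-1 *: (x + y) + (1 - 2^-1) *: (- (x - y)).
  by apply/rowP => i; rewrite !mxE; field.
by apply: vA => //; apply/andP; split; lra.
Qed.

End zonotopes.

(** * Roots of volumes and conclusion *)

Section volume_roots.
Context {R : realType}.

(** Trades the real exponent (n-1)/n for a natural power of the n-th root, after which the argument
    is polynomial. *)
Lemma powR_root (V : R) m : 0 < V -> exists2 k, 0 < k &
  V = k ^+ m.+1 /\ V `^ ((m.+1%:R - 1) / m.+1%:R) = k ^+ m.
Proof.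
move=> V0; exists (V `^ m.+1%:R^-1); first exact: powR_gt0.
have n0 : m.+1%:R != 0 :> R by rewrite pnatr_eq0.
rewrite -!powR_mulrn ?powR_ge0// -!powRrM mulVf// powRr1 ?ltW//; split => //.
by rewrite -[m.+1%:R]natr1 addrK mulrC natr1.
Qed.

Lemma volume_cube n r : 0 <= r -> volume (@cube R n r) = (r *+ 2) ^+ n.
Proof. by move=> r0; rewrite /volume -/(leb _) leb_cube. Qed.

Lemma volume_gt0 n (A : set 'rV[R]_n) x r : bmeas A -> 0 < r ->
  (forall y, cube r (y - x) -> A y) -> 0 < volume A.
Proof.
move=> bA r0 rA; apply: (@lt_le_trans _ _ (volume (mink_sum (@cube R n r) [set
  x]))).
  rewrite volume_shift; last exact: measurable_cube.
  by rewrite volume_cube ?ltW// exprn_gt0// mulrn_wgt0.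
apply: le_volume => //.
  rewrite (_ : mink_sum _ _ = (fun y => y - x) @^-1` cube r).
    rewrite -[X in measurable X]setTI.
    have : measurable_fun setT (fun y : 'rV[R]_n => y + - x) by exact:
      measurable_fun_rVD.
    by apply => //; exact: measurable_cube.
  apply/seteqP; split=> [_ [y yr [_ -> <-]]|y yr]; first by rewrite /= addrK.
  by exists (y - x) => //; exists x => //; rewrite subrK.
by move=> _ [y yr [_ -> <-]]; apply: rA; rewrite addrK.
Qed.

Lemma volume_eball_gt0 n : 0 < volume (@eball R n).
Proof. by have [r r0 rE] := @leb_eball R n; rewrite /volume -/(leb _) rE. Qed.

End volume_roots.
Unset Implicit Arguments.

Theorem theorem5 (R : realType) (n : nat) (n_gt0 : (0 < n)%N) (eps : R)
    (eps_gt0 : 0 < eps) (K L : set 'rV[R]_n)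
    (cK : convex_body K) (sK : origin_symmetric K)
    (cL : convex_body L) (sL : origin_symmetric L)
    (pL : projection_body L)
    (hKL : forall xi : 'rV[R]_n, esphere n xi ->
      volume_perp xi (proj_perp xi K) <= volume_perp xi (proj_perp xi L) - eps) :
  volume K `^ ((n%:R - 1) / n%:R) <=
    volume L `^ ((n%:R - 1) / n%:R) - c_ R n * eps.
Proof.
case: n n_gt0 K L cK sK cL sL pL hKL => // m _ K L.
move=> [cK /convex_set_convex vK iK] sK [cL /convex_set_convex vL [xL iL]] sL.
move=> [M [cM /convex_set_convex vM [xM iM]] [_ _ suppL]] hKL.
have [rK rK0 rKK] := symmetric_cube vK sK iK.
have VK : 0 < volume K.
  apply: (@volume_gt0 _ _ _ 0 rK) => //; first exact: compact_bmeas.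
  by move=> y; rewrite subr0; exact: rKK.
have L0 : L !=set0 by exists xL; exact: interior_subset.
have VL : 0 < volume L.
  have [r r0 rL] := interior_cube iL.
  by apply: (volume_gt0 _ r0 rL); exact: compact_bmeas.
have [rM rM0 rMM] := interior_cube iM.
(* [M] may be off-centre. The polytope approximation wants the origin in the interior, and [swept]
   does not see the translation. *)
pose M0 := mink_sum M [set - xM].
have cM0 : compact M0 by apply: mink_sum_compact => //; exact: compact_set1.
have vM0 : convex M0.
  apply: mink_sum_convex => // x y t -> -> _.
  by rewrite -scalerDl addrC subrK scale1r.
have rM0M : cube rM `<=` M0.
  move=> y yr; exists (y + xM); first by apply: rMM; rewrite addrK.
  by exists (- xM) => //; rewrite addrK.
(* The definition of a projection body gives this on unit vectors; both sides are positively
   homogeneous. *)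
have supE u : support_function L u = swept M0 u.
  have [lub [y Ly yE]] := support_functionP u cL L0.
  rewrite /M0 swept_shift//; have [u0|u0] := eqVneq u 0.
    by rewrite -yE u0 dotv0l swept0.
  have [xi [sxi uE]] := enormalize u0.
  rewrite {2}uE swept_volume_perp ?enorm_ge0// -suppL//.
  have eu := enorm_gt0 u0.
  have [lub' [y' Ly' yE']] := support_functionP xi cL L0.
  rewrite -yE -yE'; apply/eqP; rewrite eq_le; apply/andP; split.
    by rewrite uE dotvZl -uE; apply: ler_wpM2l; [exact: ltW|rewrite yE';
      exact: lub'].
  by rewrite -dotvZl -uE yE; exact: lub.
have hL u : (forall y, L y -> dotv u y <= swept M0 u) /\
    exists2 y, L y & dotv u y = swept M0 u.
  by rewrite -supE; exact: support_functionP.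
pose w := volume (@eball R m).
have w0 : 0 < w by exact: volume_eball_gt0.
have cB : compact (@eball R m.+1) := eball_compact.
have vB : convex (@eball R m.+1) := eball_convex.
have hz z : swept K z + eps / w * swept (eball m.+1) z <= swept L z.
  have [->|z0] := eqVneq z 0; first by rewrite !swept0 mulr0 addr0.
  have [xi [sxi ->]] := enormalize z0; have ez := enorm_gt0 z0.
  rewrite swept_eball ?(ltW ez)// !swept_volume_perp ?(ltW ez)//.
  rewrite mulrCA divfK ?gt_eqF// -mulrDr ler_pM2l//.
  by rewrite -lerBrDr; exact: hKL.
have VB := @volume_eball_gt0 R m.+1.
have [k k0 [kE ->]] := powR_root m VK.
have [l l0 [lE ->]] := powR_root m VL.
have [b b0 [bE bE']] := powR_root m VB.
rewrite /c_ bE' -/w.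
suff main : k ^+ m + eps / w * b ^+ m <= l ^+ m.
  have -> : b ^+ m / w * eps = eps / w * b ^+ m by rewrite mulrC mulrCA mulrC.
  by rewrite lerBrDr.
(* Approximating [L] by a zonotope within the factor 1 + t costs t l^m. *)
apply: (@le_of_small_perturbation _ _ _ (l ^+ m) 1) => // t /andP[t0 _].
have lam1 : 1 < 1 + t by rewrite ltrDl.
have lam0 : 0 < 1 + t by apply: lt_trans lam1.
have [s [LZ ZL]] := projection_body_zonotope cM0 vM0 rM0 rM0M cL vL L0 hL lam1.
have mK := minkowski_zonotope cK vK rK0 rKK cL L0 LZ (ltW k0) (ltW l0) kE lE.
have rB0 : 0 < m.+2%:R^-1 :> R by rewrite invr_gt0.
have mB := minkowski_zonotope cB vB rB0 (@cube_sub_eball R m.+1) cL L0 LZ (ltW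
  b0) (ltW l0) bE lE.
have mL := zonotope_swept_le cL vL lam0 ZL.
have nl : 0 < m.+1%:R * l by rewrite mulr_gt0.
rewrite -(ler_pM2l nl).
have ew : 0 <= eps / w by rewrite divr_ge0 ?ltW.
have sumle : \sum_(z <- s) swept K z + eps / w * \sum_(z <- s) swept (eball m.+1)
  z <=
    \sum_(z <- s) swept L z.
  by rewrite mulr_sumr -big_split; apply: ler_sum => z _; exact: hz.
have {}mB := ler_wpM2l ew mB.
rewrite lE exprS in mL.
have -> : m.+1%:R * l * (k ^+ m + eps / w * b ^+ m) =
  m.+1%:R * k ^+ m * l + eps / w * (m.+1%:R * b ^+ m * l) by ring.
have -> : m.+1%:R * l * (l ^+ m + t * l ^+ m) = m.+1%:R * (1 + t) * (l * l ^+ m)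
  by ring.
by apply: le_trans mL; apply: le_trans sumle; exact: lerD.
Qed.
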